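(* Let $(M,d)$ be a finite metric space with $N+1$ points ($N\ge 1$) and a distinguished point $0\in M$, and let $C\geq 1$. Then the following are equivalent: (i) the stochastic $\ell_1^N$-distortion $sd_1(M)$ of $M$ is smaller than $C$; (ii) there exists $p_0\in\mathcal{P}$ such that for every $\{x,y\}\in M^{[2]}$ there is $p\in[p_0]_{x,y}$ whose expected tree distortion in $\{x,y\}$, $\mathbb{E}_p\big(\frac{d_T(x,y)}{d(x,y)}\big)$, is smaller than $C$. Equivalently, $$sd_1(M)=\min_{p_0\in\mathcal{P}}\ \max_{\{x,y\}\in M^{[2]}}\ \min_{p\in[p_0]_{x,y}}\mathbb{E}_p\Big(\frac{d_T(x,y)}{d(x,y)}\Big).$$
   Context: Transportation cost space. $\mathrm{Lip}_0(M)$ is the space of functions $f:M\to\mathbb{R}$ with $f(0)=0$, normed by the least Lipschitz constant $\|f\|_{Lip}$; $\mathcal{F}(M)$ is its dual normed space. An element of $\mathcal{F}(M)$ is represented by a function $\mu:M\to\mathbb{R}$ acting by $\langle\mu,f\rangle=\sum_{x\in M}\mu(x)f(x)$, so $\|\mu\|=\sup_{\|f\|_{Lip}\le1}\sum_x\mu(x)f(x)$; the value $\mu(0)$ is irrelevant. $\delta_x$ is the indicator function of $x$ (so $\delta_0=0$ in $\mathcal{F}(M)$). $\dim\mathcal{F}(M)=N$. Stochastic bases. For $S\subset M$ with $0\in S$, let $\mathcal{F}(S)$ be identified with the span of $\{\delta_x:x\in S\}$ in $\mathcal{F}(M)$. A stochastic retraction onto $S$ is a map $R$ from $M$ to the probability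 measures on $S$ with $R(x)=\delta_x$ for $x\in S$; viewing probability measures on $S$ as elements of $\mathcal{F}(S)$, it extends to the linear projection $\widehat R:\mathcal{F}(M)\to\mathcal{F}(S)$, $\widehat R(\delta_x)=R(x)$, also called a stochastic retraction. For a basis $(b_n)_{n=1}^N$ of $\mathcal{F}(M)$ with dual basis $(b_n^* )$, the canonical projections are $P_n(x)=\sum_{i=1}^n b_i^*(x)b_i$. The basis is stochastic if all its canonical projections are stochastic retractions. Its $\ell_1^N$-distortion is $d_1(b_n)=\max_{\|x\|=1}\sum_{n=1}^N|b_n^*(x)|\,\|b_n\|$. The stochastic $\ell_1^N$-distortion of $M$ is $sd_1(M)=\min\{d_1(b_n):(b_n)\text{ stochastic basis of }\mathcal{F}(M)\}$. Trees. $M^{[2]}$ is the set of two-element subsets of $M$. $\Sigma(M)$ is the set of bijections $F:\{0,\dots,N\}\to M$ with $F(0)=0$ (total orders of $M$ starting at $0$). For a tree $T$ and vertices $x,y$, $[x,y]_T$ is the unique path in $T$ between $x$ and $y$, and $[x,y)_T=[x,y]_T\setminus\{y\}$ (empty if $x=y$). $\mathcal{T}(F)$ is the set of weighted trees $T$ with vertex set $M$, weight $w(\{u,v\})=d(u,v)$ for every edge, and such that $x\in[0,y)_T$ implies $x<y$ in the order $F$. $d_T$ is the weighted path distance of $T$. For $T\in\mathcal{T}(F)$, the meeting point $m_T(x,y)$ is the minimal element of $[x,y]_T$ in the order $F$ (it does not depend on $F$ with $T\in\mathcal{T}(F)$). Probabilities. $\mathcal{P}(\mathcal{T}(F))$ is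 the set of probability distributions on $\mathcal{T}(F)$ and $\mathcal{P}=\bigcup_{F\in\Sigma(M)}\mathcal{P}(\mathcal{T}(F))$ (viewed as distributions on trees with vertex set $M$ supported in some $\mathcal{T}(F)$). $\mathbb{E}_p(f(T))=\sum_T p(T)f(T)$, and $p(\text{event})$ is the $p$-probability of the set of trees $T$ satisfying the event; $\{s,t\}\in T$ (or $\in$ a path) means $\{s,t\}$ is an edge of it. A $p\in\mathcal{P}(\mathcal{T}(F))$ is $(x,y)$-independent if for every $z\in\{x,y\}$ and all $s,t\in M$ with $s>t$ in the order $F$, $$p\big(\{s,t\}\in[z,m_T(x,y)]_T\big)=p\big(\{s,t\}\in T\big)\cdot p\big(s\in[z,m_T(x,y))_T\big).$$ $p_0,p\in\mathcal{P}$ are compatible if there is $F\in\Sigma(M)$ with $p_0,p\in\mathcal{P}(\mathcal{T}(F))$ and $p_0(e\in T)=p(e\in T)$ for every $e\in M^{[2]}$. Finally, $[p_0]_{x,y}=\{p\in\mathcal{P}: p\text{ is compatible with }p_0\text{ and }(x,y)\text{-independent}\}$. *)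

(* Defs.v *)
From HB Require Import structures.
From mathcomp Require Import all_boot all_order all_algebra.
From mathcomp Require Import boolp classical_sets reals topology.

Set Implicit Arguments.
Unset Strict Implicit.
Unset Printing Implicit Defensive.

Import Order.TTheory GRing.Theory Num.Theory.
Local Open Scope classical_set_scope.
Local Open Scope ring_scope.

#[short(type="finMetricType")]
HB.structure Definition FinMetric (K : numDomainType) :=
  { M of Metric K M & Finite M }.

Definition is_dist_on (R : realType) (T : finType) (A : set T)
    (p : {ffun T -> R}) : Prop :=
  [/\ forall t, 0 <= p t, \sum_t p t = 1 & forall t, p t != 0 -> A t].

Definition is_minimum (R : realType) (A : set R) (m : R) : Prop :=
  A m /\ lbound A m.

Section TransportationCost.
Variables (R : realType) (M : finType) (o : M).

Definition ev (x : M) (f : {ffun M -> R^o}) : R^o := f x.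

Lemma ev_is_linear x : linear (ev x).
Proof. by move=> a f g; rewrite /ev !ffunE. Qed.

HB.instance Definition _ x :=
  GRing.isLinear.Build R {ffun M -> R^o} R^o _ (ev x) (ev_is_linear x).

(* The vector space Lip_0(M): since M is finite, every function vanishing at  *)
(* the base point o is Lipschitz.                                             *)
Definition lip0 : {vspace {ffun M -> R^o}} := lker (linfun (ev o)).

Lemma mem_lip0 f : (f \in lip0) = (f o == 0).
Proof. by rewrite memv_ker lfunE. Qed.

Definition ev0 (x : M) (f : subvs_of lip0) : R^o := ev x (vsval f).

Lemma ev0_is_linear x : linear (ev0 x).
Proof. by move=> a f g; rewrite /ev0 !linearP. Qed.

HB.instance Definition _ x :=
  GRing.isLinear.Build R (subvs_of lip0) R^o _ (ev0 x) (ev0_is_linear x).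

End TransportationCost.

Notation Lip0 R o := (subvs_of (@lip0 R _ o)).
Notation TC R o := 'Hom(subvs_of (@lip0 R _ o), R^o).

Section Norms.
Variables (R : realType) (M : finMetricType R) (o : M).

Definition lip_norm (f : Lip0 R o) : R :=
  inf [set L : R | 0 <= L /\
    forall x y : M, `|vsval f x - vsval f y| <= L * mdist x y].

Definition tc_norm (mu : TC R o) : R :=
  sup [set mu f | f in [set f : Lip0 R o | lip_norm f <= 1]].

Definition delta (x : M) : TC R o := linfun (ev0 (o := o) x).

Lemma deltaE x (f : Lip0 R o) : delta x f = vsval f x.
Proof. by rewrite lfunE. Qed.

Lemma delta_base : delta o = 0.
Proof.
apply/lfunP => f; rewrite deltaE lfunE /=.
by apply/eqP; rewrite -mem_lip0 subvsP.
Qed.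

(* P is the linear extension of a map r sending each point x to a probability *)
(* distribution r x on S, with r x the Dirac mass at x for x in S.            *)
Definition stochastic_retraction (P : TC R o -> TC R o) : Prop :=
  linear P /\ exists (S : {set M}) (r : M -> {ffun M -> R}),
    [/\ o \in S,
        forall x, is_dist_on [set` S] (r x),
        forall x, x \in S -> r x = [ffun y => (y == x)%:R]
      & forall x, P (delta x) = \sum_y r x y *: delta y].

Variable N : nat.

Definition canonical_projection (b : N.-tuple (TC R o)) (n : nat)
    (mu : TC R o) : TC R o :=
  \sum_(i < N | (i < n)%N) coord b i mu *: b`_i.

Definition stochastic_basis (b : N.-tuple (TC R o)) : Prop :=
  basis_of fullv b /\
  forall n, (1 <= n <= N)%N -> stochastic_retraction (canonical_projection b n).

(* The supremum is attained, the unit sphere being compact and, when N > 0,    *)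
(* nonempty.                                                                  *)
Definition d1 (b : N.-tuple (TC R o)) : R :=
  sup [set \sum_(i < N) `|coord b i mu| * tc_norm b`_i
      | mu in [set mu : TC R o | tc_norm mu = 1]].

Definition d1_values : set R :=
  [set d1 b | b in [set b : N.-tuple (TC R o) | stochastic_basis b]].

Definition sd1 : R := inf d1_values.

End Norms.

(* A graph on M is given by its set of edges, a set of pairs of points of M.  *)
Section Trees.
Variables (M : finType).
Implicit Types (T : {set {set M}}) (x y : M).

Definition adj T : rel M := fun u v => [set u; v]%SET \in T.

Definition is_tree T : Prop :=
  [/\ forall e, e \in T -> #|e| = 2%N,
      forall x y, connect (adj T) x y
    & forall c : seq M, (2 < size c)%N -> uniq c -> ~~ cycle (adj T) c].

Definition is_simple_path T x y (s : seq M) : Prop :=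
  exists s', [/\ s = x :: s', path (adj T) x s', last x s' = y & uniq s].

(* [x, y]_T, as the sequence of its vertices from x to y; the default value is *)
(* irrelevant when T is a tree.                                               *)
Definition tpath T x y : seq M := xget [::] [set s | is_simple_path T x y s].

Definition steps (s : seq M) : seq (M * M) := zip s (behead s).

Definition path_edges (s : seq M) : seq {set M} :=
  [seq [set e.1; e.2]%SET | e <- steps s].

(* v \in [x, y)_T *)
Definition in_hpath T x y v : bool := (v \in tpath T x y) && (v != y).

Variables (N : nat) (o : M).

Definition is_ordering (F : {ffun 'I_N.+1 -> M}) : Prop :=
  bijective F /\ F ord0 = o.

(* The index of x in the sequence F 0, ..., F N.                              *)
Definition pos (F : {ffun 'I_N.+1 -> M}) x : nat := index x (codom F).

Definition before (F : {ffun 'I_N.+1 -> M}) x y : bool := (pos F x < pos F y)%N.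

Definition trees (F : {ffun 'I_N.+1 -> M}) : set {set {set M}} :=
  [set T | is_tree T /\ forall x y, in_hpath T o y x -> before F x y].

Definition meeting_point (F : {ffun 'I_N.+1 -> M}) T x y : M :=
  [arg min_(v < x in tpath T x y) pos F v]%N.

End Trees.

Section Probabilities.
Variables (R : realType) (M : finMetricType R) (o : M) (N : nat).
Implicit Types (F : {ffun 'I_N.+1 -> M}) (p : {ffun {set {set M}} -> R}).

Definition tree_dist (T : {set {set M}}) (x y : M) : R :=
  \sum_(e <- steps (tpath T x y)) mdist e.1 e.2.

Definition expectation p (f : {set {set M}} -> R) : R := \sum_T p T * f T.

Definition prob p (E : pred {set {set M}}) : R := \sum_(T | E T) p T.

Definition tree_probs F : set {ffun {set {set M}} -> R} :=
  [set p | is_dist_on (trees o F) p].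

Definition all_tree_probs : set {ffun {set {set M}} -> R} :=
  [set p | exists F, is_ordering o F /\ tree_probs F p].

Definition independent_for F p (x y : M) : Prop :=
  forall z, z \in [:: x; y] -> forall s t, before F t s ->
    prob p (fun T =>
      [set s; t]%SET \in path_edges (tpath T z (meeting_point F T x y)))
    = prob p (fun T => [set s; t]%SET \in T)
      * prob p (fun T => in_hpath T z (meeting_point F T x y) s).

(* Any two orderings F with p in tree_probs F give equivalent conditions: if   *)
(* {s,t} is an edge of a tree in the support of p, the order of s and t is    *)
(* forced by the tree, and otherwise both sides vanish.                       *)
Definition independent p (x y : M) : Prop :=
  exists F, [/\ is_ordering o F, tree_probs F p & independent_for F p x y].

Definition compatible p0 p : Prop :=
  exists F, [/\ is_ordering o F, tree_probs F p0, tree_probs F p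
    & forall e : {set M}, #|e| = 2%N ->
        prob p0 (fun T => e \in T) = prob p (fun T => e \in T)].

Definition indep_class p0 (x y : M) : set {ffun {set {set M}} -> R} :=
  [set p | [/\ all_tree_probs p, compatible p0 p & independent p x y]].

Definition expected_distortion p (x y : M) : R :=
  expectation p (fun T => tree_dist T x y / mdist x y).

Definition distortion_values p0 (x y : M) : set R :=
  [set expected_distortion p x y | p in indep_class p0 x y].

(* The supremum is over a finite set, hence a maximum, nonempty when M has at  *)
(* least two points.                                                          *)
Definition max_min_distortion p0 : R :=
  sup [set inf (distortion_values p0 xy.1 xy.2)
      | xy in [set xy : M * M | xy.1 != xy.2]].

Definition max_min_values : set R :=
  [set max_min_distortion p0 | p0 in all_tree_probs].

End Probabilities.

(* Main.v *)
From HB Require Import structures.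
Require Import Defs.
From mathcomp Require Import all_boot all_order all_algebra.
From mathcomp Require Import boolp classical_sets reals topology.
From mathcomp Require Import set_interval normedtype derive.
From mathcomp Require Import ring lra.

Import Order.TTheory GRing.Theory Num.Theory.
Import numFieldNormedType.Exports.
Local Open Scope classical_set_scope.
Local Open Scope ring_scope.

Set Implicit Arguments.
Unset Strict Implicit.
Unset Printing Implicit Defensive.

(** Both sides of the equivalence are governed by the same data: an ordering of
    [M] and a kernel [q] that gives each point [s] other than [o] a probability
    distribution [q s] on the points before [s] ([parent_kernel]).

    Bases.  The vectors [delta s - \sum_t q s t *: delta t] form a stochastic
    basis: its projections run the Markov chain [q] until it enters an initial
    segment of the ordering ([kernel_basis_stochastic]).  Up to scalars every
    stochastic basis has this form, because its canonical projections retract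
    onto sets that grow by one point at a time ([stochastic_basis_kernel]).  The
    norm of such a vector is [cost q s], the mean distance from [s] to its
    parent.  The coordinates of [delta x - delta y] are the solution
    [excess q x y] of a triangular system of balance equations, that is, the
    difference of the visiting probabilities of the chains started at [x] and at
    [y].  The distortion of a basis is attained at a normalized molecule
    [delta x - delta y], because a sum of absolute values is the pairing with a
    function whose Lipschitz constant is read off from the molecules
    ([basis_sum_le]).  Hence the distortion of the basis is the maximum over
    [x != y] of the sum of the [`|excess q x y s| * cost q s], divided by the
    distance of [x] and [y] ([d1_worst_distortion]).

    Trees.  A tree compatible with the ordering is the graph of a map sending
    each point to a smaller one, its parent, and the edge probabilities of a
    random tree are such a kernel [q].  In a tree, the paths from [x] and from
    [y] to their meeting point are the differences of the two sets of ancestors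
    ([branch]).  If the random tree is independent for [x] and [y], then the
    probabilities that [s] lies on the one and on the other path satisfy, after
    subtraction, the balance equations above.  So their difference is
    [excess q x y s], while the expected tree distance is the sum over [s] of
    their sum times [cost q s].  This is the inequality [kernel_distortion_le];
    equality needs a random tree with the given edge probabilities such that no
    point lies on both paths with positive probability.

    Such a random tree is built in [coupled_parents].  A walk descends from [x]
    along the positive part of the flow [excess q x y], another one from [y]
    along the negative part, and each stops at [m] with the probability that is
    left over there.  By the balance equations these two probabilities agree,
    so the walks can be coupled to stop at the same point.  Their
    steps become edges of the tree, and every other point chooses its parent
    independently of them.

    Thus for each [p0] the least expected distortion in [x], [y] is
    [kernel_distortion q x y], with [q] the kernel of edge probabilities of [p0]
    ([min_expected_distortion]), and both sides minimize [worst_distortion] over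
    the same kernels.  The minimum is attained because for each of the
    finitely many orderings the kernels form a compact set, on which
    [worst_distortion] is continuous ([optimal_kernel]). *)

(** * Descending maps of a ranked set *)

Section Descending.
Variables (M : finType) (rk : M -> nat).
Implicit Types (f g : M -> M) (x y s t : M).

Definition descending f := forall s, f s = s \/ (rk (f s) < rk s)%N.

Lemma descending_ind f (P : M -> Prop) : descending f ->
  (forall x, (f x != x -> (rk (f x) < rk x)%N /\ P (f x)) -> P x) ->
  forall x, P x.
Proof.
move=> df IH x; move: {2}(rk x).+1 (ltnSn (rk x)) => n.
elim: n x => // n IHn x lt_xn; apply: IH => fxx.
by case: (df x) => [/eqP|lt_fx]; [rewrite (negPf fxx)|split=> //; apply: IHn;
  apply: leq_trans lt_fx _].
Qed.

Lemma fconnect_fix f x s : f x = x -> fconnect f x s = (x == s).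
Proof.
move=> fx; apply/idP/eqP => [/iter_findex <-|->]; last exact: connect0.
by elim: (findex f x s) => //= n <-.
Qed.

Lemma fconnect_rank f x s : descending f ->
  fconnect f x s -> (x == s) || (rk s < rk x)%N.
Proof.
move=> df; move: x; apply: (descending_ind df) => x IH.
have [/fconnect_fix ->|fxx] := eqVneq (f x) x; first by move=> ->.
have [lt_fx IHx] := IH fxx; rewrite fconnect_eqVf => /orP[-> //|/IHx].
by case/orP => [/eqP <-|lt_s]; rewrite ?lt_fx ?(ltn_trans lt_s lt_fx) orbT.
Qed.

Lemma fconnect_eqVf_descending f x s : descending f -> f x != x ->
  fconnect f x s = (x == s) (+) fconnect f (f x) s.
Proof.
move=> df fxx; rewrite fconnect_eqVf; case: eqVneq => //= <-.
apply/esym/negP => /(fconnect_rank df); rewrite (negPf fxx) /=.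
by case: (df x) => [/eqP|lt_fx]; [rewrite (negPf fxx)|rewrite ltnNge ltnW].
Qed.

(** A point is reached either because it is the start, or along the last step
    of the walk, whose origin is unique since the walk never comes back. *)
Lemma fconnect_last_step (R : pzRingType) f x t : descending f ->
  (fconnect f x t)%:R =
  (x == t)%:R + \sum_(s | s != t) (fconnect f x s && (f s == t))%:R :> R.
Proof.
move=> df; move: x; apply: (descending_ind df) => x IH.
have [fx|fxx] := eqVneq (f x) x.
  rewrite fconnect_fix // big1 ?addr0 // => s st.
  rewrite fconnect_fix //; case: (eqVneq x s) st => //= <-.
  by rewrite fx => /negPf ->.
have [lt_fx IHx] := IH fxx.
have step s : (fconnect f x s)%:R = (x == s)%:R + (fconnect f (f x) s)%:R :> R.
  rewrite (fconnect_eqVf_descending _ df fxx) -?IHx.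
  case: eqVneq => [<-|_] /=; last by rewrite add0r.
  case: (boolP (fconnect f (f x) x)) => [/(fconnect_rank df)|].
    by rewrite (negPf fxx) /= ltnNge ltnW.
  by rewrite addr0.
rewrite step; congr (_ + _); rewrite IHx.
transitivity (\sum_(s | s != t) (((x == s) && (f s == t))%:R +
    (fconnect f (f x) s && (f s == t))%:R) : R); last first.
  apply: eq_bigr => s _; case: (f s == t); rewrite ?andbF ?addr0 // !andbT.
  by rewrite -step.
rewrite big_split /=; congr (_ + _).
have [xt|xt] := eqVneq x t.
  subst t; rewrite (negPf fxx) big1 // => s sx.
  by rewrite eq_sym (negPf sx).
rewrite (bigD1 x) //= eqxx big1 ?addr0 // => s /andP[_ sx].
by rewrite eq_sym (negPf sx).
Qed.

Definition terminus f x : M := odflt x [pick t | fconnect f x t && (f t == t)].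

Lemma terminusP f x : descending f ->
  fconnect f x (terminus f x) /\ f (terminus f x) = terminus f x.
Proof.
move=> df; rewrite /terminus; case: pickP => [t /andP[? /eqP]//|].
move: x; apply: (descending_ind df) => x IH no_t.
have := no_t x; rewrite connect0 /= => /negbT fxx.
have [_ IHx] := IH fxx.
have H : (fun t => fconnect f (f x) t && (f t == t)) =1 xpred0.
  move=> t; have := no_t t; rewrite fconnect_eqVf.
  by case: (f t == t); rewrite ?andbF // !andbT => /norP[_ /negbTE].
by have [_ /= /eqP] := IHx H; have := no_t (f x); rewrite fconnect1 /= => ->.
Qed.

Lemma terminus_unique f x t : descending f ->
  fconnect f x t -> f t = t -> terminus f x = t.
Proof.
move=> df; have [] := terminusP x df; move: (terminus f x) => u.
move: x; apply: (descending_ind df) => x IH.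
have [fx|fxx] := eqVneq (f x) x.
  by rewrite !fconnect_fix // => /eqP <- _ /eqP <-.
have [_ IHx] := IH fxx; rewrite (fconnect_eqVf f x u) (fconnect_eqVf f x t).
move=> xu fu xt ft; apply: IHx => //.
  by case/orP: xu => // /eqP xu; rewrite xu fu eqxx in fxx.
by case/orP: xt => // /eqP xt; rewrite xt ft eqxx in fxx.
Qed.

Lemma terminus_fconnect f x s : descending f ->
  fconnect f x s -> terminus f s = terminus f x.
Proof.
move=> df xs; have [sm fm] := terminusP s df.
by apply/esym/terminus_unique => //; exact: connect_trans xs sm.
Qed.

(** If [g] agrees with [f] along the walk of [f] from [x], then its own walk first
    repeats that walk and goes on from the point where [f] stops. *)
Lemma fconnect_follow f g x s : descending f -> descending g ->
  (forall z, fconnect f x z -> f z != z -> g z = f z) ->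
  fconnect g x s =
  (fconnect f x s && (f s != s)) || fconnect g (terminus f x) s.
Proof.
move=> df dg; move: x; apply: (descending_ind df) => x IH fg.
have [fx|fxx] := eqVneq (f x) x.
  rewrite (@terminus_unique f x x) ?connect0 //.
  by rewrite (fconnect_fix s fx); case: (eqVneq x s) => // <-; rewrite fx eqxx.
have [_ IHx] := IH fxx.
have gx : g x = f x by apply: fg; rewrite ?connect0.
rewrite fconnect_eqVf gx IHx => [|z xz]; last first.
  by apply: fg; rewrite fconnect_eqVf xz orbT.
rewrite (terminus_fconnect df (fconnect1 f x)) orbA; congr (_ || _).
rewrite (fconnect_eqVf f x); case: eqVneq => [<-|//] /=.
by rewrite fxx.
Qed.

(** The points of the walk from [x] before it meets the walk from [y]. *)
Definition branch f x y s := fconnect f x s && ~~ fconnect f y s.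

(** Both walks share the part after their meeting point, which cancels in the
    difference of their balances. *)
Lemma branch_balance (R : pzRingType) f x y t : descending f ->
  (branch f x y t)%:R - (branch f y x t)%:R = (x == t)%:R - (y == t)%:R +
  \sum_(s | s != t) ((branch f x y s && (f s == t))%:R
                      - (branch f y x s && (f s == t))%:R) :> R.
Proof.
move=> df.
have E (s : M) (b : bool) : (branch f x y s && b)%:R - (branch f y x s && b)%:R =
    (fconnect f x s && b)%:R - (fconnect f y s && b)%:R :> R.
  rewrite /branch; case: b; rewrite ?andbF // !andbT.
  by case: (fconnect f x s); case: (fconnect f y s); rewrite ?subrr.
under eq_bigr do rewrite E.
have := E t true; rewrite !andbT => ->.
rewrite (fconnect_last_step R x t df) (fconnect_last_step R y t df) sumrB.
by rewrite opprD addrACA.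
Qed.

End Descending.

(** * Orderings and trees rooted at the base point *)

Section SimplePaths.
Variables (M : finType).
Implicit Types (T : {set {set M}}) (x y : M).

Lemma adj_sym T : symmetric (adj T).
Proof. by move=> u v; rewrite /adj finset.setUC. Qed.

Lemma simple_path_rev T x y s :
  is_simple_path T x y s -> is_simple_path T y x (rev s).
Proof.
move=> [s' [-> ps' ls' us]]; exists (rev (belast x s')).
have rev_s : rev (x :: s') = y :: rev (belast x s').
  by rewrite lastI ls' rev_rcons.
split; rewrite ?rev_s // -?rev_s ?rev_uniq //.
  rewrite -ls' rev_path; apply: sub_path ps' => u v /=.
  by rewrite adj_sym.
by case: s' {ps' us rev_s} ls' => [|a s'] //= _; rewrite rev_cons last_rcons.
Qed.

Lemma simple_path_refl T x s : is_simple_path T x x s -> s = [:: x].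
Proof.
move=> [[|a s'] [-> _ ls us]] //.
by case/andP: us; rewrite -{1}ls /= mem_last.
Qed.

Lemma simple_path_exists T x y :
  connect (adj T) x y -> exists s, is_simple_path T x y s.
Proof.
case/connectP => p; case/shortenP => p' pp' up' _ ->.
by exists (x :: p'), p'.
Qed.

Lemma tpathP T x y : connect (adj T) x y -> is_simple_path T x y (tpath T x y).
Proof. by move=> /simple_path_exists[s xy_s]; exact: xgetI xy_s. Qed.

End SimplePaths.

Section Ordering.
Variables (M : finType) (o : M) (N : nat) (F : {ffun 'I_N.+1 -> M}).
Hypothesis hF : is_ordering o F.

Lemma pos_inj : injective (pos F).
Proof.
have F_onto x : x \in codom F.
  by have [[G _ GK] _] := hF; rewrite -(GK x) codom_f.
by move=> x y /(congr1 (nth x (codom F))); rewrite !nth_index.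
Qed.

Lemma pos_ordering i : pos F (F i) = i.
Proof.
have Finj : injective F by have [[G FK _] _] := hF; exact: can_inj FK.
rewrite /pos codomE index_map // index_enum_ord //.
Qed.

Lemma pos_base : pos F o = 0%N.
Proof. by have [_ <-] := hF; rewrite pos_ordering. Qed.

Lemma pos_lt x : (pos F x < N.+1)%N.
Proof. by have [[G _ GK] _] := hF; rewrite -(GK x) pos_ordering. Qed.

Lemma pos_eq x y : (pos F x == pos F y) = (x == y).
Proof. by apply/eqP/eqP => [/pos_inj|->]. Qed.

Lemma before_base x : before F o x = (x != o).
Proof. by rewrite /before pos_base -pos_eq pos_base lt0n. Qed.

Lemma before_baseN x : before F x o = false.
Proof. by rewrite /before pos_base. Qed.

Lemma ordered_pair_inj s t u v : before F t s -> before F v u ->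
  [set s; t]%SET = [set u; v]%SET -> s = u /\ t = v.
Proof.
rewrite /before => ts vu /setP E.
have := E s; have := E t; rewrite !inE !eqxx orbT.
move=> /esym/orP[]/eqP Et /esym/orP[]/eqP Es //; subst.
- by rewrite ltnn in ts.
- by rewrite ltnNge ltnW in ts.
- by rewrite ltnn in ts.
Qed.

Definition parent_map (phi : M -> M) :=
  phi o = o /\ forall s, s != o -> before F (phi s) s.

Definition tree_of (phi : M -> M) : {set {set M}} :=
  [set [set s; phi s]%SET | s in [set~ o]%SET]%SET.

Section ParentMap.
Variable phi : M -> M.
Hypothesis hphi : parent_map phi.
Local Notation T := (tree_of phi).

Lemma parent_map_descending : descending (pos F) phi.
Proof.
move=> s; have [->|so] := eqVneq s o; first by left; case: hphi.
by right; have [_] := hphi; apply.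
Qed.

Lemma parent_before x y : before F y x -> before F (phi x) x.
Proof.
move=> yx; have [_] := hphi; apply; apply: contraTneq yx => ->.
by rewrite before_baseN.
Qed.

Lemma fconnect_base x : fconnect phi x o.
Proof.
move: x; apply: (descending_ind parent_map_descending) => x IH.
have [->|xo] := eqVneq x o; first exact: connect0.
have [_ /(_ _ xo) lt_x] := hphi.
rewrite fconnect_eqVf; have [|_ ->] := IH; rewrite ?orbT //.
by apply: contraTneq lt_x => ->; rewrite /before ltnn.
Qed.

Lemma edge_tree_of s t : before F t s -> ([set s; t]%SET \in T) = (phi s == t).
Proof.
move=> ts; have so : s != o by apply: contraTneq ts => ->; rewrite before_baseN.
apply/imsetP/eqP => [[r]|<-]; last by exists s => //; rewrite !inE.
rewrite !inE => ro E; have [_ /(_ _ ro) lt_r] := hphi.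
by have [-> ->] := ordered_pair_inj ts lt_r E.
Qed.


Lemma adj_tree_of u v : adj T u v ->
  before F v u /\ phi u = v \/ before F u v /\ phi v = u.
Proof.
move=> uv; have [vu|] := ltnP (pos F v) (pos F u).
  by left; split=> //; apply/eqP; rewrite -edge_tree_of.
rewrite leq_eqVlt => /predU1P[/pos_inj uv_eq|lt_uv].
  case/imsetP: uv => s; rewrite !inE uv_eq => so /setP E.
  have [_ /(_ _ so)] := hphi.
  have := E s; have := E (phi s); rewrite !inE !eqxx orbT => /orP.
  by case=> /eqP ->; case/orP => /eqP ->; rewrite /before ltnn.
right; split=> //; apply/eqP; rewrite -edge_tree_of //.
by rewrite finset.setUC.
Qed.

Lemma adj_parent x : x != o -> adj T x (phi x).
Proof. by move=> xo; apply/imsetP; exists x; rewrite ?inE. Qed.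

Lemma tree_of_connected x y : connect (adj T) x y.
Proof.
suff to_o z : connect (adj T) z o.
  by apply: connect_trans (to_o x) _; rewrite (sym_connect_sym (@adj_sym _ T)).
move: z; apply: (descending_ind parent_map_descending) => z IH.
have [->|zo] := eqVneq z o; first exact: connect0.
have [_ /(_ _ zo) lt_z] := hphi.
apply: connect_trans (connect1 (adj_parent zo)) _; have [|_ //] := IH.
by apply: contraTneq lt_z => ->; rewrite /before ltnn.
Qed.

(** A point of largest rank on a cycle would have its parent as both
    neighbours. *)
Lemma tree_of_acyclic (c : seq M) :
  (2 < size c)%N -> uniq c -> ~~ cycle (adj T) c.
Proof.
case: c => // x0 c0; set c := x0 :: c0 => c2 uc; apply/negP => cc.
have [v vc v_max] : exists2 v, v \in c & forall w, w \in c -> (pos F w <= pos F v)%N.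
  have x0c : x0 \in c by rewrite mem_head.
  by case: (arg_maxnP (pos F) x0c) => v vc v_max; exists v.
case: (rot_to vc) => i c' rot_c.
have {uc} : uniq (v :: c') by rewrite -rot_c rot_uniq.
have {c2} : (2 < size (v :: c'))%N by rewrite -rot_c size_rot.
have {cc} : cycle (adj T) (v :: c') by rewrite -rot_c rot_cycle.
have {v_max} v_max w : w \in v :: c' -> (pos F w <= pos F v)%N.
  by rewrite -rot_c mem_rot; exact: v_max.
have up w : w \in v :: c' -> adj T v w -> phi v = w.
  move=> /v_max wv /adj_tree_of[[_ //]|[]].
  by rewrite /before ltnNge wv.
case/lastP: c' up {v_max rot_c} => [//|[//|a c'] z] up.
rewrite /= !rcons_path last_rcons => /andP[va /andP[_ zv]] _ /andP[_].
have <- : phi v = a by apply: up va; rewrite !inE eqxx orbT.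
have <- : phi v = z.
  by apply: up; rewrite ?inE ?mem_rcons ?inE ?eqxx ?orbT // adj_sym.
by rewrite /= mem_rcons mem_head.
Qed.

Lemma tree_of_is_tree : is_tree T.
Proof.
split=> [e /imsetP[s]||]; last exact: tree_of_acyclic.
- rewrite !inE => so ->; have [_ /(_ _ so) lt_s] := hphi.
  by rewrite cards2; case: eqVneq lt_s => // <-; rewrite /before ltnn.
- exact: tree_of_connected.
Qed.

(** Once a simple path goes up, it cannot come down again: it would have to
    return to the parent that it left. *)
Lemma climb x a s : phi a = x -> path (adj T) a s -> uniq (x :: a :: s) ->
  (pos F a <= pos F (last a s))%N.
Proof.
elim: s x a => [|b s IHs] x a ax /=; first by rewrite leqnn.
case/andP => ab ps /and4P[]; rewrite !inE !negb_or => /and3P[xa xb xs].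
move=> /andP[a_b a_s] bs us; case: (adj_tree_of ab) => -[ord E].
  by rewrite -E ax eqxx in xb.
apply: leq_trans (ltnW ord) (IHs _ _ E ps _).
by rewrite /= inE negb_or a_b a_s bs.
Qed.

(** A path that leaves [x] upwards would end above [x]. *)
Lemma simple_path_down x y s : before F y x -> is_simple_path T x y s ->
  exists s', s = x :: s' /\ is_simple_path T (phi x) y s'.
Proof.
move=> yx [[|a s'] [-> /= ps ls us]]; first by rewrite ls /before ltnn in yx.
exists (a :: s'); split=> //; case/andP: ps => xa ps.
case: (adj_tree_of xa) => -[ord E].
  by rewrite E; exists s'; split=> //; case/andP: us.
by move: (climb E ps us); rewrite ls leqNgt (ltn_trans yx ord).
Qed.

Lemma simple_path_up x y s : before F x y -> is_simple_path T x y s ->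
  exists s', s = rcons s' y /\ is_simple_path T x (phi y) s'.
Proof.
move=> xy /simple_path_rev /(simple_path_down xy)[s' [E sp]].
by exists (rev s'); split; [rewrite -rev_cons -E revK | exact: simple_path_rev].
Qed.

(** The path between two points is found by replacing the later one by its
    parent, which is its neighbour on the path; the facts about paths below are
    proved by this induction. *)
Lemma pair_descent (P : M -> M -> Prop) :
  (forall x, P x x) ->
  (forall x y, before F y x -> P (phi x) y -> P x y) ->
  (forall x y, before F x y -> P x (phi y) -> P x y) ->
  forall x y, P x y.
Proof.
move=> P0 Pd Pu x y; move: {2}(_ + _).+1 (ltnSn (pos F x + pos F y)) => n.
elim: n x y => // n IHn x y le_n; case: (ltngtP (pos F x) (pos F y)) => [xy|yx|].
- apply: (Pu _ _ xy); apply: IHn; rewrite -ltnS; apply: leq_trans le_n.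
  by rewrite ltnS ltn_add2l; exact: parent_before xy.
- apply: (Pd _ _ yx); apply: IHn; rewrite -ltnS; apply: leq_trans le_n.
  by rewrite ltnS ltn_add2r; exact: parent_before yx.
- by move/pos_inj->.
Qed.

Lemma simple_path_unique x y s1 s2 :
  is_simple_path T x y s1 -> is_simple_path T x y s2 -> s1 = s2.
Proof.
move: x y s1 s2; apply: pair_descent => [x|x y yx IH|x y xy IH] s1 s2.
- by move=> /simple_path_refl -> /simple_path_refl ->.
- move=> /(simple_path_down yx)[s1' [-> p1]] /(simple_path_down yx)[s2' [-> p2]].
  by rewrite (IH _ _ p1 p2).
- move=> /(simple_path_up xy)[s1' [-> p1]] /(simple_path_up xy)[s2' [-> p2]].
  by rewrite (IH _ _ p1 p2).
Qed.

Lemma tpath_simple x y : is_simple_path T x y (tpath T x y).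
Proof. exact/tpathP/tree_of_connected. Qed.

Lemma tpath_refl x : tpath T x x = [:: x].
Proof. exact: simple_path_refl (tpath_simple x x). Qed.

Lemma tpath_down x y : before F y x -> tpath T x y = x :: tpath T (phi x) y.
Proof.
move=> /simple_path_down/(_ (tpath_simple x y))[s' [-> p]].
by rewrite (simple_path_unique p (tpath_simple _ _)).
Qed.

Lemma tpath_up x y : before F x y -> tpath T x y = rcons (tpath T x (phi y)) y.
Proof.
move=> /simple_path_up/(_ (tpath_simple x y))[s' [-> p]].
by rewrite (simple_path_unique p (tpath_simple _ _)).
Qed.

Lemma mem_tpath_ends x y : (x \in tpath T x y) && (y \in tpath T x y).
Proof.
by have [s' [-> _ <- _]] := tpath_simple x y; rewrite mem_head mem_last.
Qed.

Local Notation anc := (fconnect phi).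

Lemma tpath_base s : tpath T o s =i anc s.
Proof.
move: s; apply: (descending_ind parent_map_descending) => s IH v.
have [->|so] := eqVneq s o.
  by rewrite tpath_refl inE [RHS]fconnect_fix 1?eq_sym //; case: hphi.
have [_ /(_ _ so) lt_s] := hphi.
have [|_ E] := IH; first by apply: contraTneq lt_s => ->; rewrite /before ltnn.
rewrite tpath_up ?before_base // mem_rcons inE E.
by rewrite [RHS]fconnect_eqVf eq_sym.
Qed.

Lemma anc_rank x s : anc x s -> (x == s) || before F s x.
Proof. exact: (fconnect_rank parent_map_descending). Qed.

Lemma tree_of_trees : trees o F T.
Proof.
split=> [|x y /andP[]]; first exact: tree_of_is_tree.
rewrite tpath_base => /anc_rank; rewrite eq_sym.
by case: (x == y).
Qed.

Lemma ancN x y : before F x y -> anc x y = false.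
Proof.
move=> xy; apply: contraTF xy => /anc_rank /predU1P[->|].
  by rewrite /before ltnn.
by rewrite /before -leqNgt; exact: ltnW.
Qed.

Lemma tpath_anc x m s : anc x m -> in_hpath T x m s = anc x s && ~~ anc m s.
Proof.
move: x; apply: (descending_ind parent_map_descending) => x IH.
have [->|xm] := eqVneq x m.
  by rewrite andbN /in_hpath tpath_refl inE andbN.
rewrite fconnect_eqVf (negPf xm) /= => fxm.
have mx : before F m x.
  by have := anc_rank (connect_trans (fconnect1 phi x) fxm); rewrite (negPf xm).
have fxx : phi x != x by apply: contraNneq xm => fx; rewrite fx fconnect_fix in fxm.
have [_ /(_ fxm)] := IH fxx; rewrite /in_hpath (tpath_down mx) inE (fconnect_eqVf phi x).
by case: (eqVneq s x) => [->|sx] E; rewrite /= ?xm ?(ancN mx).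
Qed.

Lemma path_edges_anc x m s t : anc x m -> before F t s ->
  ([set s; t]%SET \in path_edges (tpath T x m)) =
  [&& anc x s, ~~ anc m s & phi s == t].
Proof.
move=> + ts; move: x; apply: (descending_ind parent_map_descending) => x IH.
have [->|xm] := eqVneq x m.
  by rewrite andbA andbN tpath_refl.
rewrite fconnect_eqVf (negPf xm) /= => fxm.
have mx : before F m x.
  by have := anc_rank (connect_trans (fconnect1 phi x) fxm); rewrite (negPf xm).
have fxx : phi x != x by apply: contraNneq xm => fx; rewrite fx fconnect_fix in fxm.
have lt_x := parent_before mx.
have [_ /(_ fxm) E] := IH fxx; rewrite (tpath_down mx) (fconnect_eqVf phi x).
have [s' [Es' _ _ _]] := tpath_simple (phi x) m.
rewrite Es' in E *.
rewrite -[path_edges _]/([set x; phi x]%SET :: path_edges (phi x :: s')).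
rewrite in_cons E.
case: eqVneq => [/(ordered_pair_inj ts lt_x)[-> ->]|neq] /=.
  by rewrite !eqxx (ancN mx).
case: (eqVneq x s) => //= xs; subst s; case: (phi x =P t) => [pt|]; last by rewrite !andbF.
by rewrite pt eqxx in neq.
Qed.

(** The path goes down from [x] to the last common ancestor and then up to [y], so
    its minimum is this ancestor. *)
Lemma meeting_pointP x y : let m := meeting_point F T x y in
  [/\ anc x m, anc y m & forall s, anc x s -> anc y s -> anc m s].
Proof.
suff [m [mp m_min ax ay am]] : exists m, [/\ m \in tpath T x y,
    forall v, v \in tpath T x y -> (pos F m <= pos F v)%N,
    anc x m, anc y m & forall s, anc x s -> anc y s -> anc m s].
  rewrite /meeting_point; have /andP[xp _] := mem_tpath_ends x y.
  case: (arg_minnP (pos F) xp) => v vp v_min.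
  suff -> : v = m by [].
  by apply/pos_inj/eqP; rewrite eqn_leq m_min // v_min.
move: x y; apply: pair_descent => [x|x y yx [m [mp m_min ax ay am]]|x y xy
    [m [mp m_min ax ay am]]].
- exists x; rewrite tpath_refl; split=> //; rewrite ?mem_head ?connect0 //.
  by move=> v; rewrite inE => /eqP ->.
- exists m; rewrite tpath_down // inE mp orbT; split=> //.
  + move=> v; rewrite inE => /predU1P[->|/m_min //].
    have /andP[_ /m_min] := mem_tpath_ends (phi x) y.
    by move/leq_trans; apply; exact: ltnW.
  + by rewrite fconnect_eqVf ax orbT.
  + move=> s; rewrite fconnect_eqVf => /predU1P[<-|]; last exact: am.
    by rewrite ancN.
- exists m; rewrite tpath_up // mem_rcons inE mp orbT; split=> //.
  + move=> v; rewrite mem_rcons inE => /predU1P[->|/m_min //].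
    have /andP[/m_min] := mem_tpath_ends x (phi y).
    by move/leq_trans => H _; apply: H; exact: ltnW.
  + by rewrite fconnect_eqVf ay orbT.
  + move=> s xs; rewrite fconnect_eqVf => /predU1P[ys|]; last exact: am.
    by rewrite -ys ancN in xs.
Qed.

(** All common ancestors of [x] and [y] are ancestors of the meeting point, so
    the two half paths are the differences of the sets of ancestors and do not
    mention that point. *)
Lemma in_hpath_meeting x y s : let m := meeting_point F T x y in
  (in_hpath T x m s = branch phi x y s) *
  (in_hpath T y m s = branch phi y x s).
Proof.
move=> m; have [xm ym m_max] := meeting_pointP x y.
rewrite !tpath_anc // /branch; split; apply/andP/andP => -[as_ nas]; split=> //.
- by apply: contra nas; exact: m_max.
- by apply: contra nas; exact: connect_trans ym.
- by apply: contra nas => /m_max; apply.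
- by apply: contra nas; exact: connect_trans xm.
Qed.

Lemma path_edges_meeting x y s t : before F t s ->
  let m := meeting_point F T x y in
  (([set s; t]%SET \in path_edges (tpath T x m)) =
    branch phi x y s && (phi s == t)) *
  (([set s; t]%SET \in path_edges (tpath T y m)) =
    branch phi y x s && (phi s == t)).
Proof.
move=> ts m; have [xm ym _] := meeting_pointP x y.
rewrite !path_edges_anc // !andbA.
by case: (in_hpath_meeting x y s) => /=; rewrite !tpath_anc // => -> ->.
Qed.

(** The parent of [s] is the vertex before [s] on the path from [o]; at [s = o]
    there is none, and the default value makes [o] its own parent. *)
Lemma parent_of_tree s : nth o (rev (tpath T o s)) 1 = phi s.
Proof.
have [->|so] := eqVneq s o; first by rewrite tpath_refl; case: hphi.
rewrite tpath_up ?before_base // rev_rcons.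
have [s' [E _ _ _]] := simple_path_rev (tpath_simple o (phi s)).
by rewrite /= E.
Qed.

End ParentMap.

(** In a tree of [trees o F], let [phi s] be the vertex before [s] on the path
    from [o].  An edge that is not of the form [{s, phi s}] would close a cycle
    with the path in [tree_of phi] between its ends. *)
Lemma trees_parent_map (T : {set {set M}}) : trees o F T ->
  exists2 phi : {ffun M -> M}, parent_map phi & T = tree_of phi.
Proof.
move=> [[T2 Tc Ta] To].
have ex s : exists t, s != o -> adj T s t /\ before F t s.
  have [->|so] := eqVneq s o; first by exists o.
  have [s' [E ps ls us]] := tpathP (Tc o s).
  case/lastP: s' E ps ls us => [|s' b] E ps; first by move=> /= os; rewrite os eqxx in so.
  rewrite last_rcons => bs us; subst b; exists (last o s') => _.
  move: ps; rewrite rcons_path => /andP[_ ab]; split; first by rewrite adj_sym.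
  apply: To; rewrite /in_hpath E -rcons_cons mem_rcons inE mem_last orbT /=.
  by move: us; rewrite E -rcons_cons rcons_uniq => /andP[+ _]; apply: contraNneq => <-; rewrite mem_last.
have [g g_spec] := boolp.choice ex.
pose phi : {ffun M -> M} := [ffun s => if s == o then o else g s].
have hphi : parent_map phi.
  by split=> [|s so]; rewrite ffunE ?eqxx // (negPf so); case: (g_spec s so).
have sub u v : adj (tree_of phi) u v -> adj T u v.
  case/(adj_tree_of hphi) => -[ord <-]; rewrite ffunE.
    by case: eqVneq ord => [->|uo _]; [rewrite before_baseN|case: (g_spec u uo)].
  by case: eqVneq ord => [->|vo _]; [rewrite before_baseN|rewrite adj_sym; case: (g_spec v vo)].
exists phi => //; apply/setP => e; apply/idP/idP => [eT|]; last first.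
  by case/imsetP => s so ->; apply: sub; apply/imsetP; exists s.
have /eqP/cards2P[u [v [uv E]]] := T2 e eT; subst e.
have [//|nadj] := boolP ([set u; v]%SET \in tree_of phi).
have [s [ps sp]] := tpath_simple hphi u v.
case: sp => sp ls us.
have := Ta (tpath (tree_of phi) u v); rewrite us ps /= rcons_path ls.
rewrite (sub_path sub sp) adj_sym /adj eT /=.
case: s {ps us} sp ls => [|a [|b s]] /=; first by move=> _ uv'; rewrite uv' eqxx in uv.
  by rewrite andbT => ua av; move: ua; rewrite av /adj (negPf nadj).
by move=> _ _ /(_ isT isT).
Qed.
End Ordering.

Lemma steps_cons (M : finType) (a b : M) s :
  steps [:: a, b & s] = (a, b) :: steps (b :: s).
Proof. by []. Qed.

Lemma steps_rcons (M : finType) (a : M) s y :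
  steps (rcons (a :: s) y) = rcons (steps (a :: s)) (last a s, y).
Proof. by elim: s a => // b s IHs a; rewrite !rcons_cons !steps_cons -rcons_cons IHs. Qed.

(** The path from [x] to [y] consists of the edges from the points of the two
    branches to their parents. *)
Lemma tree_dist_branch (R : realType) (M : finMetricType R) (o : M) (N : nat)
    (F : {ffun 'I_N.+1 -> M}) (phi : M -> M) x y :
  is_ordering o F -> parent_map o F phi ->
  tree_dist (tree_of o phi) x y = \sum_s
    ((branch phi x y s)%:R + (branch phi y x s)%:R) * mdist s (phi s) :> R.
Proof.
move=> hF hphi; move: x y; apply: (pair_descent hF hphi) => [x|x y yx IH|x y xy IH].
- rewrite /tree_dist (tpath_refl hphi) big_nil big1 // => s _.
  by rewrite /branch andbN addr0 mul0r.
- rewrite /tree_dist (tpath_down hF hphi yx).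
  have [s' [Es' _ _ _]] := tpath_simple hphi (phi x) y.
  move: IH; rewrite /tree_dist Es' => IH; rewrite steps_cons big_cons IH.
  rewrite (bigD1 x) //= [in RHS](bigD1 x) //=.
  rewrite /branch (ancN hphi yx) connect0 /=.
  rewrite (ancN hphi (parent_before hF hphi yx)).
  rewrite /= !addr0 mul1r mul0r add0r; congr (_ + _).
  apply: eq_bigr => s sx; rewrite (fconnect_eqVf phi x s) eq_sym (negPf sx).
  by [].
- rewrite /tree_dist (tpath_up hF hphi xy).
  have [s' [Es' _ ls _]] := tpath_simple hphi x (phi y).
  move: IH; rewrite /tree_dist Es' => IH; rewrite steps_rcons -cats1 big_cat IH big_seq1 ls /=.
  rewrite addrC (bigD1 y) //= [in RHS](bigD1 y) //=.
  rewrite /branch (ancN hphi xy) connect0 /=.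
  rewrite (ancN hphi (parent_before hF hphi xy)).
  rewrite /= !add0r mul1r mul0r add0r metric_sym; congr (_ + _).
  apply: eq_bigr => s sy; rewrite (fconnect_eqVf phi y s) (eq_sym y) (negPf sy).
  by [].
Qed.

(** * Random descending maps *)

Section ProductLaw.
Variables (R : realType) (M : finType).
Implicit Types (K : M -> M -> R) (f : {ffun M -> M}).

Definition prod_law K f : R := \prod_s K s (f s).

Definition visit K x s : R := \sum_f prod_law K f * (fconnect f x s)%:R.

Lemma prod_law_ge0 K f : (forall s t, 0 <= K s t) -> 0 <= prod_law K f.
Proof. by move=> K0; apply: prodr_ge0 => s _. Qed.

Lemma prod_law_neq0 K f s : prod_law K f != 0 -> K s (f s) != 0.
Proof. by rewrite /prod_law (bigD1 s) //= mulf_eq0 negb_or => /andP[]. Qed.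

Lemma prod_law_sum K :
  (forall s, \sum_t K s t = 1) -> \sum_f prod_law K f = 1.
Proof. by move=> K1; rewrite -bigA_distr_bigA big1. Qed.

Definition update f s a : {ffun M -> M} := [ffun r => if r == s then a else f r].

(** The value at [s] of a product law is independent of every function of the
    other values; these are compared by changing only the value at [s]. *)
Lemma prod_law_indep K (g : {ffun M -> M} -> R) s t :
  (forall s, \sum_t K s t = 1) ->
  (forall f a, g (update f s a) = g f) ->
  \sum_f prod_law K f * (g f * (f s == t)%:R) =
  (\sum_f prod_law K f * g f) * K s t.
Proof.
move=> K1 gu.
pose H a : R := \sum_(f : {ffun M -> M} | f s == a) (\prod_(r | r != s) K r (f r)) * g f.
have fiber a : \sum_(f : {ffun M -> M} | f s == a) prod_law K f * g f = K s a * H a.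
  rewrite /H mulr_sumr; apply: eq_bigr => f /eqP fs.
  by rewrite /prod_law (bigD1 s) //= fs mulrA.
have Hconst a b : H a = H b.
  rewrite /H (reindex_onto (fun f => update f s a) (fun f => update f s b)) /=.
    apply: eq_big => f.
      rewrite ffunE eqxx eqxx /=; apply/eqP/eqP => [<-|fb].
        by rewrite ffunE eqxx.
      by apply/ffunP => r; rewrite !ffunE; case: eqVneq => // ->.
    move=> _; rewrite gu; congr (_ * _); apply: eq_bigr => r rs.
    by rewrite ffunE (negPf rs).
  move=> f /eqP fa; apply/ffunP => r; rewrite !ffunE.
  by case: eqVneq => // ->.
have -> : \sum_f prod_law K f * g f = H t.
  rewrite (partition_big (fun f : {ffun M -> M} => f s) xpredT) //=.
  under eq_bigr do rewrite fiber (Hconst _ t).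
  by rewrite -mulr_suml K1 mul1r.
rewrite mulrC -fiber [RHS]big_mkcond /=; apply: eq_bigr => f _.
by case: eqP => _; rewrite ?mulr1 // !mulr0.
Qed.

Lemma fconnect_update f s a x : fconnect (update f s a) x s = fconnect f x s.
Proof.
have impl (f1 f2 : M -> M) : (forall r, r != s -> f1 r = f2 r) ->
    fconnect f1 x s -> fconnect f2 x s.
  move=> E /iter_findex; move: (findex f1 x s) => n; elim: n x => [|n IHn] z /=.
    by move=> ->; exact: connect0.
  rewrite -iterS iterSr fconnect_eqVf; case: eqVneq => //= zs /IHn.
  by rewrite E.
by apply/idP/idP; apply: impl => r rs; rewrite ffunE (negPf rs).
Qed.

(** Whether the walk reaches [s] does not depend on where it goes from [s]. *)
Lemma visit_step K x s t : (forall s, \sum_t K s t = 1) ->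
  \sum_f prod_law K f * (fconnect f x s && (f s == t))%:R = visit K x s * K s t.
Proof.
move=> K1; rewrite -prod_law_indep //; last by move=> f a; rewrite fconnect_update.
by apply: eq_bigr => f _; rewrite -natrM mulnb.
Qed.

Lemma prod_law_marginal K s t : (forall s, \sum_t K s t = 1) ->
  \sum_f prod_law K f * (f s == t)%:R = K s t.
Proof.
move=> K1; have := @prod_law_indep K (fun=> 1) s t K1 (fun _ _ => erefl).
under eq_bigr do rewrite mul1r.
by move=> ->; under eq_bigr do rewrite mulr1; rewrite prod_law_sum // mul1r.
Qed.

Variable rk : M -> nat.

Definition descending_kernel K :=
  forall s t, K s t != 0 -> (s == t) || (rk t < rk s)%N.

(** Balance equations are triangular, so they are solved from the points of
    highest rank down. *)
Lemma balance_unique K (P : pred M) (b v1 v2 : M -> R) : descending_kernel K ->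
  (forall s t, P t -> K s t != 0 -> P s) ->
  (forall t, P t -> v1 t = b t + \sum_(s | s != t) v1 s * K s t) ->
  (forall t, P t -> v2 t = b t + \sum_(s | s != t) v2 s * K s t) ->
  forall t, P t -> v1 t = v2 t.
Proof.
move=> dK PK v1E v2E t; pose B := (\max_s rk s)%N.
move: {2}(B - rk t).+1 (ltnSn (B - rk t)) => n.
elim: n t => // n IHn t le_n Pt.
rewrite v1E // v2E //; congr (_ + _); apply: eq_bigr => s st.
have [->|Kst] := eqVneq (K s t) 0; first by rewrite !mulr0.
rewrite IHn ?(PK _ _ Pt Kst) // -ltnS; apply: leq_trans le_n; rewrite ltnS.
have := dK _ _ Kst; rewrite (negPf st) /= => ts.
by rewrite ltn_sub2l // (leq_trans ts) // leq_bigmax.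
Qed.

Lemma prod_law_descending K f : descending_kernel K ->
  prod_law K f != 0 -> descending rk f.
Proof.
move=> dK Kf s; case/orP: (dK _ _ (prod_law_neq0 s Kf)) => [/eqP <-|]; first by left.
by right.
Qed.

Lemma visit_rec K x t : descending_kernel K -> (forall s, \sum_t K s t = 1) ->
  visit K x t = (x == t)%:R + \sum_(s | s != t) visit K x s * K s t.
Proof.
move=> dK K1.
under eq_bigr do rewrite -visit_step //.
have -> : (x == t)%:R = \sum_f prod_law K f * (x == t)%:R.
  by rewrite -mulr_suml prod_law_sum // mul1r.
rewrite exchange_big /= -big_split /=.
apply: eq_bigr => f _; rewrite -mulr_sumr -mulrDr.
have [->|/(prod_law_descending dK) df] := eqVneq (prod_law K f) 0; first by rewrite !mul0r.
by rewrite -(fconnect_last_step R x t df).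
Qed.

End ProductLaw.

(** * Parent kernels and their signed flows *)

Section Kernel.
Variables (R : realType) (M : finMetricType R) (o : M) (N : nat).
Implicit Types (F : {ffun 'I_N.+1 -> M}) (q : M -> M -> R) (x y s t : M).

Definition parent_kernel F q :=
  [/\ forall s t, 0 <= q s t, forall s, \sum_t q s t = 1 &
      forall s t, q s t != 0 -> (s == o) && (t == o) || before F t s].

(** By the balance equations [excess_rec], a signed flow of strength one from [x]
    to [y] along the edges of the kernel. *)
Definition excess q x y s : R := visit q x s - visit q y s.

Definition cost q s : R := \sum_t q s t * mdist s t.

(** The cost of the flow, relative to the distance that it has to cover. *)
Definition kernel_distortion q x y : R :=
  (\sum_s `|excess q x y s| * cost q s) / mdist x y.

Section Fixed.
Variables (F : {ffun 'I_N.+1 -> M}) (q : M -> M -> R).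
Hypotheses (hF : is_ordering o F) (hq : parent_kernel F q).

Lemma parent_kernel_descending : descending_kernel (pos F) q.
Proof.
move=> s t; case: hq => _ _ H /H /orP[/andP[/eqP-> /eqP->]|ts]; first by rewrite eqxx.
by rewrite [(_ < _)%N]ts orbT.
Qed.

Lemma parent_kernel_law f : prod_law q f != 0 -> parent_map o F f.
Proof.
move=> qf; case: hq => _ _ H; split=> [|s so].
  have /orP[/andP[_ /eqP //]|] := H _ _ (prod_law_neq0 o qf).
  by rewrite (before_baseN hF).
by have := H _ _ (prod_law_neq0 s qf); rewrite (negPf so).
Qed.

Lemma cost_ge0 s : 0 <= cost q s.
Proof.
by apply: sumr_ge0 => t _; apply: mulr_ge0; rewrite ?mdist_ge0 //; case: hq.
Qed.

Lemma visit_base x : visit q x o = 1.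
Proof.
have [_ q1 _] := hq; rewrite -(prod_law_sum q1).
apply: eq_bigr => f _; have [->|/parent_kernel_law hf] := eqVneq (prod_law q f) 0.
  by rewrite mul0r.
by rewrite (fconnect_base hf) mulr1.
Qed.

Lemma excess_base x y : excess q x y o = 0.
Proof. by rewrite /excess !visit_base subrr. Qed.

Lemma excess_rec x y t : excess q x y t = (x == t)%:R - (y == t)%:R +
  \sum_(s | s != t) excess q x y s * q s t.
Proof.
have [_ q1 _] := hq; have dq := parent_kernel_descending.
rewrite /excess (visit_rec x t dq q1) (visit_rec y t dq q1) opprD addrACA.
congr (_ + _); rewrite -sumrB; apply: eq_bigr => s _.
by rewrite mulrBl.
Qed.

Lemma excess_unique x y (v : M -> R) :
  (forall t, t != o -> v t = (x == t)%:R - (y == t)%:R + \sum_(s | s != t) v s * q s t) ->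
  forall t, t != o -> v t = excess q x y t.
Proof.
move=> vE; apply: (balance_unique (P := predC1 o) parent_kernel_descending _ vE).
  move=> s t to qst; apply: contraNneq to => so; have [_ _ /(_ _ _ qst)] := hq.
  by rewrite so (before_baseN hF) orbF => /andP[].
by move=> t _; exact: excess_rec.
Qed.

Section RandomTree.
Variables (W : finType) (w : W -> R) (phi : W -> {ffun M -> M}) (x y : M).
Hypothesis w_phi : forall i, w i != 0 -> parent_map o F (phi i).

Definition branch_prob a b s : R := \sum_i w i * (branch (phi i) a b s)%:R.

Hypotheses (indep_xy : forall s t,
    \sum_i w i * (branch (phi i) x y s && (phi i s == t))%:R =
    branch_prob x y s * q s t)
  (indep_yx : forall s t,
    \sum_i w i * (branch (phi i) y x s && (phi i s == t))%:R =
    branch_prob y x s * q s t).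
Hypothesis w_sum : \sum_i w i = 1.

Lemma branch_prob_base a b : branch_prob a b o = 0.
Proof.
apply: big1 => i _; have [->|/w_phi hi] := eqVneq (w i) 0; first by rewrite mul0r.
by rewrite /branch (fconnect_base hi b) andbF mulr0.
Qed.

(** By independence, the balance of the two branches in each tree averages to the
    balance equations of the kernel, which have only one solution. *)
Lemma branch_prob_excess t :
  branch_prob x y t - branch_prob y x t = excess q x y t.
Proof.
have [->|to] := eqVneq t o; first by rewrite excess_base !branch_prob_base subrr.
pose v s := branch_prob x y s - branch_prob y x s.
rewrite -[LHS]/(v t); apply: excess_unique to => {}t to.
have -> : \sum_(s | s != t) v s * q s t = \sum_i w i * \sum_(s | s != t)
   ((branch (phi i) x y s && (phi i s == t))%:R -
    (branch (phi i) y x s && (phi i s == t))%:R).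
  under eq_bigr do rewrite mulrBl -indep_xy -indep_yx -sumrB.
  rewrite exchange_big; apply: eq_bigr => i _; rewrite mulr_sumr.
  by apply: eq_bigr => s _; rewrite mulrBr.
have -> : (x == t)%:R - (y == t)%:R = \sum_i w i * ((x == t)%:R - (y == t)%:R).
  by rewrite -mulr_suml w_sum mul1r.
rewrite -big_split /v -sumrB /=.
apply: eq_bigr => i _; have [->|/w_phi hi] := eqVneq (w i) 0; first by rewrite !mul0r subrr addr0.
rewrite -mulrBr -mulrDr; congr (_ * _).
exact: branch_balance (parent_map_descending hi).
Qed.

(** By independence, the mean length of the step from [s] is [cost q s], whether
    or not [s] is on a branch. *)
Lemma expected_branch_dist :
  \sum_i w i * (\sum_s ((branch (phi i) x y s)%:R + (branch (phi i) y x s)%:R) *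
     mdist s (phi i s)) =
  \sum_s (branch_prob x y s + branch_prob y x s) * cost q s.
Proof.
transitivity (\sum_i \sum_s \sum_t
    (w i * (branch (phi i) x y s && (phi i s == t))%:R +
     w i * (branch (phi i) y x s && (phi i s == t))%:R) * mdist s t).
  apply: eq_bigr => i _; rewrite mulr_sumr; apply: eq_bigr => s _.
  rewrite (bigD1 (phi i s)) //= eqxx !andbT big1 ?addr0 => [|t].
    by rewrite -mulrDr mulrA.
  by rewrite eq_sym => /negPf ->; rewrite !andbF mulr0 addr0 mul0r.
rewrite exchange_big; apply: eq_bigr => s _.
rewrite exchange_big /cost mulr_sumr; apply: eq_bigr => t _.
by rewrite -mulr_suml big_split /= indep_xy indep_yx -mulrDl mulrA.
Qed.

End RandomTree.
End Fixed.
End Kernel.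

(** * Distributions on trees and their edge laws *)

Section EdgeLaw.
Variables (R : realType) (M : finMetricType R) (o : M) (N : nat).
Implicit Types (F : {ffun 'I_N.+1 -> M}) (p : {ffun {set {set M}} -> R}).
Implicit Types (T : {set {set M}}) (x y s t : M).

(** Read off the path from [o], so that it does not depend on an ordering. *)
Definition parent T : {ffun M -> M} := [ffun s => nth o (rev (tpath T o s)) 1].

Definition edge_law p s t : R := \sum_T p T * (parent T s == t)%:R.

Lemma parent_tree_of F (phi : {ffun M -> M}) :
  is_ordering o F -> parent_map o F phi -> parent (tree_of o phi) = phi.
Proof. by move=> hF hphi; apply/ffunP => s; rewrite ffunE (parent_of_tree hF). Qed.

Lemma trees_parent F T : is_ordering o F -> trees o F T ->
  parent_map o F (parent T) /\ T = tree_of o (parent T).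
Proof.
by move=> hF /(trees_parent_map hF)[phi hphi ->]; rewrite (parent_tree_of hF hphi).
Qed.

Lemma prob_sum p (E : pred {set {set M}}) :
  prob p E = \sum_T p T * (E T)%:R.
Proof.
rewrite /prob big_mkcond; apply: eq_bigr => T _.
by case: (E T); rewrite ?mulr1 ?mulr0.
Qed.

Section Fixed.
Variables (F : {ffun 'I_N.+1 -> M}) (p : {ffun {set {set M}} -> R}).
Hypotheses (hF : is_ordering o F) (hp : tree_probs o F p).

Lemma tree_probs_parent T : p T != 0 ->
  parent_map o F (parent T) /\ T = tree_of o (parent T).
Proof. by move=> pT; apply: trees_parent => //; case: hp => _ _; apply. Qed.

Lemma tree_probs_eq (f g : {set {set M}} -> R) :
  (forall T, parent_map o F (parent T) -> T = tree_of o (parent T) -> f T = g T) ->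
  \sum_T p T * f T = \sum_T p T * g T.
Proof.
move=> fg; apply: eq_bigr => T _; have [->|/tree_probs_parent[hT ET]] := eqVneq (p T) 0.
  by rewrite !mul0r.
by rewrite fg.
Qed.

Lemma edge_law_kernel : parent_kernel o F (edge_law p).
Proof.
have [p0 p1 _] := hp; split=> [s t|s|s t].
- by apply: sumr_ge0 => T _; rewrite mulr_ge0.
- rewrite exchange_big /= -[RHS]p1; apply: eq_bigr => T _.
  rewrite -mulr_sumr (bigD1 (parent T s)) //= eqxx big1 ?addr0 ?mulr1 // => t.
  by rewrite eq_sym => /negPf ->.
- move=> neq0; have [T pT] : exists T, p T * (parent T s == t)%:R != 0.
    apply: contrapT => no; move: neq0; rewrite /edge_law big1 ?eqxx // => T _.
    by apply/eqP; apply: contrapT => /negP pT; apply: no; exists T.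
  move: pT; rewrite mulf_eq0 negb_or pnatr_eq0 eqb0 negbK.
  case/andP => /tree_probs_parent[[To Ts] _] /eqP <-.
  by have [->|so] := eqVneq s o; [rewrite To eqxx|rewrite Ts].
Qed.

Lemma prob_edge s t : before F t s ->
  prob p (fun T => [set s; t]%SET \in T) = edge_law p s t.
Proof.
move=> ts; rewrite prob_sum; apply: tree_probs_eq => T hT ET.
by rewrite {1}ET (edge_tree_of hF hT ts).
Qed.

Lemma prob_branch x y s :
  prob p (fun T => in_hpath T x (meeting_point F T x y) s) =
    branch_prob p parent x y s /\
  prob p (fun T => in_hpath T y (meeting_point F T x y) s) =
    branch_prob p parent y x s.
Proof.
by split; rewrite prob_sum; apply: tree_probs_eq => T hT ET;
   rewrite {1 2}ET !(in_hpath_meeting hF hT).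
Qed.

Lemma prob_path_edge x y s t : before F t s ->
  prob p (fun T =>
      [set s; t]%SET \in path_edges (tpath T x (meeting_point F T x y))) =
    \sum_T p T * (branch (parent T) x y s && (parent T s == t))%:R /\
  prob p (fun T =>
      [set s; t]%SET \in path_edges (tpath T y (meeting_point F T x y))) =
    \sum_T p T * (branch (parent T) y x s && (parent T s == t))%:R.
Proof.
by move=> ts; split; rewrite prob_sum; apply: tree_probs_eq => T hT ET;
   rewrite {1 2}ET !(path_edges_meeting hF hT).
Qed.

(** The definition of independence asks only for [t] before [s]; in the other
    cases both sides vanish, so the equation may be summed over all [t]. *)
Lemma branch_step_trivial x y s t : ~~ before F t s ->
  \sum_T p T * (branch (parent T) x y s && (parent T s == t))%:R =
  branch_prob p parent x y s * edge_law p s t.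
Proof.
move=> ts; transitivity (0 : R).
  apply: big1 => T _; have [->|/tree_probs_parent[hT _]] := eqVneq (p T) 0.
    by rewrite mul0r.
  have [->|so] := eqVneq s o.
    by rewrite /branch (fconnect_base hT y) andbF mulr0.
  have [_ /(_ _ so)] := hT; case: eqP => [-> /(negP ts) //|_].
  by rewrite andbF mulr0.
have [->|so] := eqVneq s o.
  rewrite (branch_prob_base (F := F)) ?mul0r // => T pT.
  by have [] := tree_probs_parent pT.
have [_ _ /(_ s t)] := edge_law_kernel; rewrite (negPf so) (negPf ts) /=.
by case: eqVneq => [->|_ /(_ isT)]; rewrite ?mulr0.
Qed.

Lemma independent_forP x y : independent_for F p x y <->
  (forall s t, \sum_T p T * (branch (parent T) x y s && (parent T s == t))%:R =
               branch_prob p parent x y s * edge_law p s t) /\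
  (forall s t, \sum_T p T * (branch (parent T) y x s && (parent T s == t))%:R =
               branch_prob p parent y x s * edge_law p s t).
Proof.
split=> [ind|[indx indy] z zxy s t ts].
  split=> s t; have [ts|] := boolP (before F t s); try exact: branch_step_trivial.
    have := ind x (mem_head _ _) s t ts.
    have [-> _] := prob_path_edge x y ts; have [-> _] := prob_branch x y s.
    by rewrite prob_edge // mulrC.
  have := ind y _ s t ts; rewrite !inE eqxx orbT => /(_ isT).
  have [_ ->] := prob_path_edge x y ts; have [_ ->] := prob_branch x y s.
  by rewrite prob_edge // mulrC.
have [Ex Ey] := prob_path_edge x y ts; have [Bx By] := prob_branch x y s.
move: zxy; rewrite !inE => /orP[]/eqP->.
  by rewrite Ex Bx indx prob_edge // mulrC.
by rewrite Ey By indy prob_edge // mulrC.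
Qed.

Lemma expected_distortionE x y : expected_distortion p x y =
  (\sum_T p T * \sum_s ((branch (parent T) x y s)%:R +
     (branch (parent T) y x s)%:R) * mdist s (parent T s)) / mdist x y.
Proof.
rewrite /expected_distortion /expectation.
under eq_bigr do rewrite mulrA.
rewrite -mulr_suml; congr (_ / _); apply: tree_probs_eq => T hT ET.
by rewrite {1}ET (tree_dist_branch _ _ hF hT).
Qed.

(** In an independent distribution the two branches carry the flow [excess],
    and cancellation between them only lowers its cost. *)
Lemma kernel_distortion_le x y : independent_for F p x y ->
  kernel_distortion (edge_law p) x y <= expected_distortion p x y.
Proof.
move/independent_forP => [indx indy]; have [_ p1 _] := hp.
have hT T : p T != 0 -> parent_map o F (parent T) by move=> /tree_probs_parent[].
rewrite expected_distortionE (expected_branch_dist indx indy).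
rewrite ler_wpM2r ?invr_ge0 ?mdist_ge0 //; apply: ler_sum => s _.
rewrite ler_wpM2r ?(cost_ge0 edge_law_kernel) //.
rewrite -(branch_prob_excess hF edge_law_kernel hT indx indy p1).
have b0 a b : 0 <= branch_prob p parent a b s.
  by apply: sumr_ge0 => T _; rewrite mulr_ge0 //; case: hp.
by rewrite (le_trans (ler_normB _ _)) // !ger0_norm.
Qed.

End Fixed.
End EdgeLaw.

(** * Coupling two walks that carry a signed flow *)

Lemma sum_neq0 (R : nmodType) (I : finType) (P : pred I) (f : I -> R) :
  \sum_(i | P i) f i != 0 -> exists2 i, P i & f i != 0.
Proof.
move=> neq0; apply: contrapT => no; move: neq0; rewrite big1 ?eqxx // => i Pi.
by apply/eqP/negPn/negP => fi; apply: no; exists i.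
Qed.

(** Two distributions whose images agree are glued by making them conditionally
    independent given the common image. *)
Lemma gluing (R : realType) (A B C : finType) (wa : A -> R) (wb : B -> R)
    (ea : A -> C) (eb : B -> C) :
  (forall a, 0 <= wa a) -> (forall b, 0 <= wb b) ->
  (forall c, \sum_(a | ea a == c) wa a = \sum_(b | eb b == c) wb b) ->
  exists g : A -> B -> R, [/\ forall a b, 0 <= g a b,
    forall a, \sum_b g a b = wa a, forall b, \sum_a g a b = wb b &
    forall a b, g a b != 0 -> [/\ wa a != 0, wb b != 0 & ea a = eb b]].
Proof.
move=> wa0 wb0 wab; pose k c := \sum_(a | ea a == c) wa a.
have k0 c : 0 <= k c by exact: sumr_ge0.
have wa_k a : k (ea a) = 0 -> wa a = 0.
  by move=> /psumr_eq0P ->.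
have wb_k b : k (eb b) = 0 -> wb b = 0.
  by rewrite /k wab => /psumr_eq0P ->.
(* Where [k] vanishes so do the weights, and the quotient is zero as it should. *)
exists (fun a b => wa a * wb b * (ea a == eb b)%:R / k (ea a)); split=> [a b|a|b|a b].
- by rewrite !mulr_ge0 ?invr_ge0.
- have [k_a|k_a] := eqVneq (k (ea a)) 0.
    by rewrite big1 ?(wa_k a) // => b _; rewrite !mul0r.
  rewrite -mulr_suml; under eq_bigr do rewrite -mulrA.
  rewrite -mulr_sumr -mulrA.
  have -> : \sum_b wb b * (ea a == eb b)%:R = k (ea a).
    rewrite /k wab [RHS]big_mkcond; apply: eq_bigr => b _.
    by rewrite eq_sym; case: eqP => _; rewrite ?mulr1 ?mulr0.
  by rewrite divff ?mulr1.
- transitivity (\sum_(a | ea a == eb b) wa a * (wb b / k (eb b))).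
    rewrite [RHS]big_mkcond; apply: eq_bigr => a _.
    by case: eqP => [->|_]; rewrite ?mulr1 ?mulr0 ?mul0r // mulrA.
  rewrite -mulr_suml -/(k _).
  have [k_b|k_b] := eqVneq (k (eb b)) 0; first by rewrite k_b mul0r wb_k.
  by rewrite mulrCA divff ?mulr1.
- rewrite !mulf_eq0 !negb_or pnatr_eq0 eqb0 negbK => /andP[/andP[/andP[-> ->]]].
  by move=> /eqP.
Qed.

Section Coupling.
Variables (R : realType) (M : finMetricType R) (o : M) (N : nat).
Variables (F : {ffun 'I_N.+1 -> M}) (q : M -> M -> R).
Hypotheses (hF : is_ordering o F) (hq : parent_kernel o F q).

(** The probability of reaching [s] from [x], when [v r * q r s] is the probability
    of the step from [r] to [s]. *)
Definition inflow (v : M -> R) x s : R :=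
  (x == s)%:R + \sum_(r | r != s) v r * q r s.

Lemma parent_kernel_diag s : s != o -> q s s = 0.
Proof.
move=> so; apply/eqP/negPn/negP => qss; have [_ _ /(_ _ _ qss)] := hq.
by rewrite (negPf so) /before ltnn.
Qed.

(** A walk from [x] that leaves [s] with total probability [v s], distributed
    over its steps by [q].  Having reached [s], it goes on to [t] with probability
    [v s * q s t / inflow v x s] and stops otherwise. *)
Lemma stopped_walk (v : M -> R) x : (forall s, 0 <= v s) -> v o = 0 ->
  (forall s, v s <= inflow v x s) ->
  exists w : {ffun M -> M} -> R, [/\ forall f, 0 <= w f,
    \sum_f w f = 1,
    forall f, w f != 0 -> descending (pos F) f /\ forall s, f s != s -> v s != 0,
    forall s t, s != t ->
      \sum_f w f * (fconnect f x s && (f s == t))%:R = v s * q s t &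
    forall m, \sum_(f : {ffun M -> M} | terminus f x == m) w f = inflow v x m - v m].
Proof.
move=> v0 vo v_le; set I := inflow v x in v_le *; have [q0 q1 q_supp] := hq.
have I0 s : 0 <= I s by exact: le_trans (v0 s) (v_le s).
have vI s : I s = 0 -> v s = 0.
  by move=> Is; apply/eqP; rewrite eq_le v0 andbT -Is.
(* A point without inflow is not reached, and its row is chosen freely. *)
pose K s t := if I s == 0 then (s == t)%:R
  else (v s * q s t + (I s - v s) * (s == t)%:R) / I s.
have K0 s t : 0 <= K s t.
  rewrite /K; case: ifP => // _; rewrite mulr_ge0 ?invr_ge0 // addr_ge0 //.
    exact: mulr_ge0.
  by rewrite mulr_ge0 // subr_ge0.
have delta1 s : \sum_t (s == t)%:R = 1 :> R.
  by rewrite (bigD1 s) //= eqxx big1 ?addr0 // => t; rewrite eq_sym => /negPf ->.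
have K1 s : \sum_t K s t = 1.
  rewrite /K; case: eqVneq => [_|Is]; first exact: delta1.
  by rewrite -mulr_suml big_split /= -!mulr_sumr q1 delta1 !mulr1 addrC subrK divff.
have IK s t : s != t -> I s * K s t = v s * q s t.
  move=> st; rewrite /K (negPf st) mulr0 addr0; case: eqVneq => [Is|Is].
    by rewrite mulr0 vI // mul0r.
  by rewrite mulrC divfK.
have dK : descending_kernel (pos F) K.
  move=> s t Kst; case: eqVneq => //= st; have := IK _ _ st => /esym/eqP.
  have [Is|Is] := eqVneq (I s) 0; first by move: Kst; rewrite /K Is eqxx (negPf st) eqxx.
  move=> E; have : q s t != 0.
    by apply: contraNneq Kst => qst; move: E; rewrite qst mulr0 eq_sym mulf_eq0 (negPf Is).
  by move=> /q_supp /orP[/andP[/eqP so /eqP to]|//]; rewrite so to eqxx in st.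
have visitI s : visit K x s = I s.
  apply: (balance_unique (P := xpredT) (b := fun t => (x == t)%:R) dK) => // t _.
    exact: visit_rec dK K1.
  rewrite {1}/I /inflow; congr (_ + _); apply: eq_bigr => r rt.
  by rewrite IK.
exists (prod_law K); split=> [f||f Kf|s t st|m].
- exact: prod_law_ge0.
- exact: prod_law_sum.
- split; first exact: prod_law_descending Kf.
  move=> s fs; have := prod_law_neq0 s Kf; rewrite eq_sym in fs.
  apply: contraNneq => vs; rewrite /K (negPf fs); case: ifP => // _.
  by rewrite vs mul0r mulr0 addr0 mul0r.
- by rewrite visit_step // visitI IK.
transitivity (\sum_f prod_law K f * (fconnect f x m && (f m == m))%:R).
  rewrite big_mkcond; apply: eq_bigr => f _.
  have [->|/(prod_law_descending dK) df] := eqVneq (prod_law K f) 0.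
    by rewrite mul0r if_same.
  have [xm fm] := terminusP x df.
  case: eqP => [<-|ne]; first by rewrite xm fm eqxx mulr1.
  case: (boolP (fconnect f x m && _)) => [/andP[? /eqP ?]|_]; last by rewrite mulr0.
  by case: ne; apply: terminus_unique df _ _.
rewrite visit_step // visitI /K eqxx; case: eqVneq => [Im|Im].
  by rewrite Im vI // mulr1 subr0.
rewrite mulrC divfK // mulr1; have [->|mo] := eqVneq m o.
  by rewrite vo mul0r add0r.
by rewrite parent_kernel_diag // mulr0 add0r.
Qed.

Definition posp (u : M -> R) s : R := Num.max (u s) 0.
Definition negp (u : M -> R) s : R := Num.max (- u s) 0.

Lemma posp_negp u s :
  [/\ 0 <= posp u s, 0 <= negp u s, posp u s - negp u s = u s,
      posp u s + negp u s = `|u s| & (posp u s = 0 \/ negp u s = 0)].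
Proof.
rewrite /posp /negp; case: (ler0P (u s)) => us.
  have -> : Num.max (- u s) 0 = - u s by apply/max_idPl; rewrite oppr_ge0.
  by rewrite lexx oppr_ge0 us sub0r opprK add0r; split=> //; left.
have -> : Num.max (- u s) 0 = 0 by apply/max_idPr; rewrite oppr_le0 ltW.
by rewrite lexx subr0 addr0 ltW //; split=> //; right.
Qed.

(** Follow a stopped walk from [x] carrying the positive part of the flow and
    one from [y] carrying the negative part, coupled to stop at the same point;
    everywhere else, choose parents independently.  The two walks are disjoint
    as no point carries flow of both signs. *)
Lemma coupled_parents x y (u := excess q x y) :
  exists (W : finType) (w : W -> R) (phi : W -> {ffun M -> M}),
  [/\ (forall i, 0 <= w i) /\ \sum_i w i = 1,
      forall i, w i != 0 -> parent_map o F (phi i),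
      forall s t, \sum_i w i * (phi i s == t)%:R = q s t,
      forall s t, \sum_i w i * (branch (phi i) x y s && (phi i s == t))%:R =
        posp u s * q s t &
      forall s t, \sum_i w i * (branch (phi i) y x s && (phi i s == t))%:R =
        negp u s * q s t].
Proof.
have [q0 q1 q_supp] := hq.
have pn s := posp_negp u s.
have up0 s : 0 <= posp u s by case: (pn s).
have um0 s : 0 <= negp u s by case: (pn s).
have uI s : inflow (posp u) x s - inflow (negp u) y s = u s.
  rewrite /inflow opprD addrACA -sumrB [RHS](excess_rec hq); congr (_ + _).
  by apply: eq_bigr => r _; rewrite -mulrBl; case: (pn r) => _ _ ->.
have I0 v z s : (forall r, 0 <= v r) -> 0 <= inflow v z s.
  by move=> v0; rewrite addr_ge0 // sumr_ge0 // => r _; rewrite mulr_ge0.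
(* What is left over at [s] is the probability of stopping there; its equality for
   the two walks is what allows to couple their ends. *)
have stop s : inflow (posp u) x s - posp u s = inflow (negp u) y s - negp u s.
  case: (pn s) => _ _ E _ _.
  by apply/eqP; rewrite subr_eq addrAC -addrA E -(uI s) subrKC.
have up_le s : posp u s <= inflow (posp u) x s.
  case: (pn s) => _ _ E _ [->|E2]; first exact: I0.
  by rewrite -subr_ge0 stop E2 subr0 I0.
have um_le s : negp u s <= inflow (negp u) y s.
  by rewrite -subr_ge0 -stop subr_ge0.
have uo : u o = 0 by exact: (excess_base hF hq).
have upo : posp u o = 0 by rewrite /posp uo maxxx.
have umo : negp u o = 0 by rewrite /negp uo oppr0 maxxx.
have [wa [wa0 wa1 wa_supp wa_step wa_stop]] := stopped_walk up0 upo up_le.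
have [wb [wb0 wb1 wb_supp wb_step wb_stop]] := stopped_walk um0 umo um_le.
have [|g [g0 ga gb g_supp]] := @gluing R _ _ _ wa wb
  (fun f : {ffun M -> M} => terminus f x) (fun f : {ffun M -> M} => terminus f y) wa0 wb0.
  by move=> m; rewrite wa_stop wb_stop stop.
pose A (a : {ffun M -> M}) s := fconnect a x s && (a s != s).
pose B (b : {ffun M -> M}) s := fconnect b y s && (b s != s).
pose phi (i : {ffun M -> M} * {ffun M -> M} * {ffun M -> M}) : {ffun M -> M} :=
  [ffun s => if A i.1.1 s then i.1.1 s else if B i.1.2 s then i.1.2 s else i.2 s].
pose w (i : {ffun M -> M} * {ffun M -> M} * {ffun M -> M}) : R :=
  g i.1.1 i.1.2 * prod_law q i.2.
have AB a b s : g a b != 0 -> A a s -> B b s -> False.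
  move=> /g_supp[/wa_supp[_ va] /wb_supp[_ vb] _] /andP[_ /va up] /andP[_ /vb um].
  by case: (pn s) => _ _ _ _ [E|E]; [rewrite E eqxx in up|rewrite E eqxx in um].
have phi_parent i : w i != 0 -> parent_map o F (phi i).
  case: i => -[a b] c; rewrite mulf_eq0 negb_or /= => /andP[gab /(parent_kernel_law hF hq)[co cs]].
  have [/wa_supp[da va] /wb_supp[db vb] _] := g_supp _ _ gab.
  have Ao : A a o = false.
    by apply/negP => /andP[_ /va]; rewrite upo eqxx.
  have Bo : B b o = false.
    by apply/negP => /andP[_ /vb]; rewrite umo eqxx.
  split=> [|s so]; rewrite ffunE /= ?Ao ?Bo //.
  case: ifP => [/andP[_ /eqP as_]|_]; first by case: (da s).
  by case: ifP => [/andP[_ /eqP bs]|_]; [case: (db s)|exact: cs].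
have branchE i s : w i != 0 ->
    branch (phi i) x y s = A i.1.1 s /\ branch (phi i) y x s = B i.1.2 s.
  move=> wi; have dphi := parent_map_descending (phi_parent _ wi).
  case: i wi dphi => -[a b] c /= wi dphi.
  have gab : g a b != 0 by move: wi; rewrite mulf_eq0 negb_or => /andP[].
  have [/wa_supp[da va] /wb_supp[db vb] eab] := g_supp _ _ gab.
  have folA := @fconnect_follow _ _ a (phi (a, b, c)) x _ da dphi.
  have folB := @fconnect_follow _ _ b (phi (a, b, c)) y _ db dphi.
  have {folA} xE r : fconnect (phi (a, b, c)) x r =
      A a r || fconnect (phi (a, b, c)) (terminus a x) r.
    by apply: folA => z xz az; rewrite ffunE /= /A xz az.
  have {folB} yE r : fconnect (phi (a, b, c)) y r =
      B b r || fconnect (phi (a, b, c)) (terminus b y) r.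
    apply: folB => z yz bz; have Bz : B b z by rewrite /B yz bz.
    by rewrite ffunE /= Bz; case: ifP => // Az; case: (AB _ _ _ gab Az Bz).
  (* The rank decreases along a walk, so the ancestors of its end are not among the
     points that it has left. *)
  have above f z r : descending (pos F) f -> fconnect f z r -> f r != r ->
      fconnect (phi (a, b, c)) (terminus f z) r = false.
    move=> df zr fr; rewrite -(terminus_fconnect df zr).
    have [rm fm] := terminusP r df.
    have mr : r != terminus f r by apply: contraNneq fr => ->; rewrite fm.
    apply/negP => /(fconnect_rank dphi); rewrite eq_sym (negPf mr) /=.
    have := fconnect_rank df rm; rewrite (negPf mr) /= => /ltnW.
    by rewrite leqNgt => /negPf ->.
  rewrite /branch xE yE eab; split.
    case: (boolP (A a s)) => [As|_] /=; last first.
      by case: (fconnect _ _ s); rewrite ?orbT.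
    case: (boolP (B b s)) => [/(AB _ _ _ gab As)//|_] /=.
    by case/andP: As => xs as_; rewrite -eab above.
  case: (boolP (B b s)) => [Bs|_] /=; last first.
    by case: (fconnect _ _ s); rewrite ?orbT.
  case: (boolP (A a s)) => [As|_] /=; first by case: (AB _ _ _ gab As Bs).
  by case/andP: Bs => ys bs; rewrite above.
have sum_w (h : {ffun M -> M} -> {ffun M -> M} -> R) (k : {ffun M -> M} -> R) :
    \sum_i w i * (h i.1.1 i.1.2 * k i.2) =
    (\sum_a \sum_b g a b * h a b) * \sum_c prod_law q c * k c.
  rewrite -(pair_bigA _ (fun ab c => w (ab, c) * (h ab.1 ab.2 * k c))) /=.
  rewrite [in RHS]pair_bigA mulr_suml; apply: eq_bigr => -[a b] _ /=.
  by rewrite mulr_sumr; apply: eq_bigr => c _; rewrite /w /= mulrACA.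
have qk1 : \sum_c prod_law q c * 1 = 1.
  by under eq_bigr do rewrite mulr1; exact: prod_law_sum.
have sum_a (h : {ffun M -> M} -> R) : \sum_i w i * h i.1.1 = \sum_a wa a * h a.
  under eq_bigr do rewrite -[h _]mulr1.
  rewrite (sum_w (fun a _ => h a) (fun=> 1)) qk1 mulr1.
  by apply: eq_bigr => a _; rewrite -mulr_suml ga.
have sum_b (h : {ffun M -> M} -> R) : \sum_i w i * h i.1.2 = \sum_b wb b * h b.
  under eq_bigr do rewrite -[h _]mulr1.
  rewrite (sum_w (fun _ b => h b) (fun=> 1)) qk1 mulr1 exchange_big.
  by apply: eq_bigr => b _; rewrite -mulr_suml gb.
have stepA s t : \sum_i w i * (A i.1.1 s && (i.1.1 s == t))%:R = posp u s * q s t.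
  rewrite (sum_a (fun a => (A a s && (a s == t))%:R)).
  have [<-|st] := eqVneq s t.
    rewrite big1 => [|a _]; last by rewrite /A -andbA andNb andbF mulr0.
    have [->|so] := eqVneq s o; first by rewrite upo mul0r.
    by rewrite parent_kernel_diag // mulr0.
  rewrite -wa_step //; apply: eq_bigr => a _; rewrite /A -andbA.
  by case: (a s =P t) => [->|_]; rewrite ?andbF // andbT eq_sym st andbT.
have stepB s t : \sum_i w i * (B i.1.2 s && (i.1.2 s == t))%:R = negp u s * q s t.
  rewrite (sum_b (fun a => (B a s && (a s == t))%:R)).
  have [<-|st] := eqVneq s t.
    rewrite big1 => [|a _]; last by rewrite /B -andbA andNb andbF mulr0.
    have [->|so] := eqVneq s o; first by rewrite umo mul0r.
    by rewrite parent_kernel_diag // mulr0.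
  rewrite -wb_step //; apply: eq_bigr => a _; rewrite /B -andbA.
  by case: (a s =P t) => [->|_]; rewrite ?andbF // andbT eq_sym st andbT.
have one_step (X : bool) (z : M) : \sum_t (X && (z == t))%:R = X%:R :> R.
  rewrite (bigD1 z) //= eqxx andbT big1 ?addr0 // => t.
  by rewrite eq_sym => /negPf ->; rewrite andbF.
have massA s : \sum_i w i * (A i.1.1 s)%:R = posp u s.
  have -> : posp u s = \sum_t posp u s * q s t by rewrite -mulr_sumr q1 mulr1.
  under [RHS]eq_bigr do rewrite -stepA.
  by rewrite exchange_big; apply: eq_bigr => i _; rewrite -mulr_sumr one_step.
have massB s : \sum_i w i * (B i.1.2 s)%:R = negp u s.
  have -> : negp u s = \sum_t negp u s * q s t by rewrite -mulr_sumr q1 mulr1.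
  under [RHS]eq_bigr do rewrite -stepB.
  by rewrite exchange_big; apply: eq_bigr => i _; rewrite -mulr_sumr one_step.
have w1 : \sum_i w i = 1.
  transitivity (\sum_i w i * 1); first by apply: eq_bigr => i _; rewrite mulr1.
  by rewrite (sum_a (fun=> 1)); under eq_bigr do rewrite mulr1.
exists _, w, phi; split=> //.
- by split=> // i; rewrite mulr_ge0 // prod_law_ge0.
- move=> s t; pose h a b : R := 1 - (A a s)%:R - (B b s)%:R.
  transitivity (\sum_i (w i * (A i.1.1 s && (i.1.1 s == t))%:R +
      w i * (B i.1.2 s && (i.1.2 s == t))%:R +
      w i * (h i.1.1 i.1.2 * (i.2 s == t)%:R))).
    apply: eq_bigr => -[[a b] c] _ /=; rewrite -!mulrDr.
    have [->|] := eqVneq (w (a, b, c)) 0; first by rewrite !mul0r.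
    rewrite mulf_eq0 negb_or => /andP[gab _]; congr (_ * _).
    rewrite /h ffunE /=; case: (boolP (A a s)) => [As|_].
      case: (boolP (B b s)) => [/(AB _ _ _ gab As)//|_] /=.
      by rewrite subrr subr0 mul0r !addr0.
    by case: (B b s); rewrite /= ?subr0 ?subrr ?mul0r ?mul1r ?add0r ?addr0.
  rewrite !big_split /= stepA stepB.
  rewrite (sum_w h (fun c => (c s == t)%:R)) prod_law_marginal //.
  have -> : \sum_a \sum_b g a b * h a b = 1 - posp u s - negp u s.
    have := sum_w h (fun=> 1); rewrite qk1 mulr1 => <-.
    under eq_bigr do rewrite mulr1 !mulrBr mulr1.
    by rewrite !sumrB w1 massA massB.
  by rewrite -!mulrDl -[1 - _ - _]addrA -opprD subrKC mul1r.
- move=> s t; rewrite -stepA; apply: eq_bigr => i _.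
  have [->|wi] := eqVneq (w i) 0; first by rewrite !mul0r.
  have [-> _] := branchE _ s wi; congr (_ * _); rewrite ffunE.
  by case: (A _ s).
- move=> s t; rewrite -stepB; apply: eq_bigr => i _.
  have [->|wi] := eqVneq (w i) 0; first by rewrite !mul0r.
  have [_ ->] := branchE _ s wi; congr (_ * _); rewrite ffunE.
  case: (boolP (B _ s)) => // Bs; case: ifP => // As.
  by move: wi; rewrite mulf_eq0 negb_or => /andP[gab _]; case: (AB _ _ _ gab As Bs).
Qed.

End Coupling.

(** * The least expected distortion for given edge probabilities *)

Lemma sup_attained (R : realType) (A : set R) m : A m -> ubound A m -> sup A = m.
Proof.
move=> Am um; apply/eqP; rewrite eq_le ge_sup //=; last by exists m.
by apply: ub_le_sup => //; exists m.
Qed.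

Lemma minimum_inf (R : realType) (A : set R) m : is_minimum A m -> inf A = m.
Proof.
move=> [Am lm]; apply/eqP; rewrite eq_le lb_le_inf ?andbT //; last by exists m.
by apply: ge_inf => //; exists m.
Qed.

Section Minimum.
Variables (R : realType) (M : finMetricType R) (o : M) (N : nat).
Implicit Types (F : {ffun 'I_N.+1 -> M}) (p : {ffun {set {set M}} -> R}).
Implicit Types (q : M -> M -> R).

(** The law of the tree of [coupled_parents]. Its two branches carry the two parts
    of the flow without cancellation, so their total cost is least possible. *)
Lemma coupled_tree_law F q x y : is_ordering o F -> parent_kernel o F q ->
  exists p, [/\ tree_probs o F p, edge_law o p = q, independent_for F p x y &
    expected_distortion p x y = kernel_distortion q x y].
Proof.
move=> hF hq; have [_ q1 _] := hq.
have [W [w [phi [[w0 w1] hphi marg step_xy step_yx]]]] := coupled_parents hF hq x y.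
pose p : {ffun {set {set M}} -> R} :=
  [ffun T => \sum_(i | tree_of o (phi i) == T) w i].
have p_sum (g : {set {set M}} -> R) :
    \sum_T p T * g T = \sum_i w i * g (tree_of o (phi i)).
  rewrite (partition_big (fun i => tree_of o (phi i)) xpredT) //=.
  apply: eq_bigr => T _; rewrite ffunE mulr_suml; apply: eq_bigr => i /eqP <-.
  by [].
have p_parent (g : {ffun M -> M} -> R) :
    \sum_T p T * g (parent o T) = \sum_i w i * g (phi i).
  rewrite p_sum; apply: eq_bigr => i _; have [->|wi] := eqVneq (w i) 0.
    by rewrite !mul0r.
  by rewrite (parent_tree_of hF (hphi _ wi)).
have hp : tree_probs o F p.
  split=> [T||T]; first by rewrite ffunE sumr_ge0.
    have := p_sum (fun=> 1); under eq_bigr do rewrite mulr1; move=> ->.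
    by under eq_bigr do rewrite mulr1.
  rewrite ffunE => /sum_neq0[i /eqP <- /hphi hi].
  exact: tree_of_trees.
have pq : edge_law o p = q.
  apply/funext => s; apply/funext => t.
  by rewrite /edge_law (p_parent (fun f => (f s == t)%:R)) marg.
have Bx s : branch_prob p (parent o) x y s = posp (excess q x y) s.
  rewrite /branch_prob (p_parent (fun f => (branch f x y s)%:R)).
  have -> : posp (excess q x y) s = \sum_t posp (excess q x y) s * q s t.
    by rewrite -mulr_sumr q1 mulr1.
  under [RHS]eq_bigr do rewrite -step_xy.
  rewrite exchange_big; apply: eq_bigr => i _; rewrite -mulr_sumr; congr (_ * _).
  rewrite (bigD1 (phi i s)) //= eqxx andbT big1 ?addr0 // => t.
  by rewrite eq_sym => /negPf ->; rewrite andbF.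
have By s : branch_prob p (parent o) y x s = negp (excess q x y) s.
  rewrite /branch_prob (p_parent (fun f => (branch f y x s)%:R)).
  have -> : negp (excess q x y) s = \sum_t negp (excess q x y) s * q s t.
    by rewrite -mulr_sumr q1 mulr1.
  under [RHS]eq_bigr do rewrite -step_yx.
  rewrite exchange_big; apply: eq_bigr => i _; rewrite -mulr_sumr; congr (_ * _).
  rewrite (bigD1 (phi i s)) //= eqxx andbT big1 ?addr0 // => t.
  by rewrite eq_sym => /negPf ->; rewrite andbF.
have indx s t : \sum_T p T * (branch (parent o T) x y s && (parent o T s == t))%:R =
    branch_prob p (parent o) x y s * edge_law o p s t.
  by rewrite (p_parent (fun f => (branch f x y s && (f s == t))%:R)) step_xy Bx pq.
have indy s t : \sum_T p T * (branch (parent o T) y x s && (parent o T s == t))%:R =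
    branch_prob p (parent o) y x s * edge_law o p s t.
  by rewrite (p_parent (fun f => (branch f y x s && (f s == t))%:R)) step_yx By pq.
exists p; split=> //; first exact/(independent_forP hF hp).
rewrite (expected_distortionE hF hp) (expected_branch_dist indx indy) pq.
congr (_ / _); apply: eq_bigr => s _; rewrite Bx By.
by have [_ _ _ -> _] := posp_negp (excess q x y) s.
Qed.

Lemma parent_kernelN F q s t : is_ordering o F -> parent_kernel o F q ->
  ~~ before F t s -> q s t = ((s == o) && (t == o))%:R.
Proof.
move=> hF [_ q1 q_supp] ts; have [|] := boolP ((s == o) && (t == o)); last first.
  move=> nso; apply/eqP/negPn/negP => /q_supp.
  by rewrite (negPf nso) (negPf ts).
case/andP=> /eqP -> /eqP ->; rewrite -(q1 o) (bigD1 o) //= big1 ?addr0 // => r ro.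
apply/eqP/negPn/negP => /q_supp.
by rewrite (negPf ro) andbF (before_baseN hF).
Qed.

(** The edge law is oriented, while compatibility compares unoriented edges; but a
    common ordering orients the edges of both. *)
Lemma compatible_edge_law p0 p : compatible o N p0 p -> edge_law o p = edge_law o p0.
Proof.
move=> [F [hF hp0 hp E]]; apply/funext => s; apply/funext => t.
have [ts|ts] := boolP (before F t s).
  rewrite -(prob_edge hF hp ts) -(prob_edge hF hp0 ts) E // cards2.
  by case: eqVneq ts => // ->; rewrite /before ltnn.
by rewrite !(parent_kernelN hF _ ts) //; exact: edge_law_kernel.
Qed.

(** The orderings that witness compatibility and independence may differ, but the
    edge law does not depend on them, and it determines both bounds. *)
Lemma min_expected_distortion p0 x y : all_tree_probs o N p0 ->
  is_minimum (distortion_values o N p0 x y) (kernel_distortion (edge_law o p0) x y).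
Proof.
move=> [F [hF hp0]]; have hq := edge_law_kernel hF hp0.
split=> [|_ [p [_ /compatible_edge_law <- [F' [hF' hp' ind]]] <-]]; last first.
  exact: kernel_distortion_le hF' hp' _ _ ind.
have [p [hp pq ind Ep]] := coupled_tree_law x y hF hq.
exists p => //; split; [by exists F|exists F; split=> //|by exists F].
move=> e /eqP/cards2P[s [t [st ->]]].
wlog ts : s t st / before F t s.
  move=> H; case: (ltngtP (pos F s) (pos F t)) => [ts|ts|/(pos_inj hF)/eqP].
  - by rewrite finset.setUC; apply: H; rewrite 1?eq_sym.
  - exact: H.
  - by rewrite (negPf st).
by rewrite !(prob_edge hF _ ts) ?pq.
Qed.

Definition worst_distortion q : R :=
  \big[Num.max/0]_(xy : M * M | xy.1 != xy.2) kernel_distortion q xy.1 xy.2.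

Lemma kernel_distortion_ge0 F q x y : parent_kernel o F q -> 0 <= kernel_distortion q x y.
Proof.
move=> hq; rewrite /kernel_distortion divr_ge0 ?mdist_ge0 // sumr_ge0 // => s _.
by rewrite mulr_ge0 // (cost_ge0 hq).
Qed.

Lemma worst_distortionP F q : (1 < #|M|)%N -> parent_kernel o F q ->
  (exists xy : M * M, xy.1 != xy.2 /\ worst_distortion q = kernel_distortion q xy.1 xy.2) /\
  (forall x y, x != y -> kernel_distortion q x y <= worst_distortion q).
Proof.
move=> M2 hq; have [x [y [_ _ xy]]] := card_gt1P M2.
split=> [|{}x {}y {}xy]; last exact: (le_bigmax_cond _ _ (j := (x, y))).
have [xy' ne E] := @eq_bigmax _ R _ 0 (x, y) (fun xy : M * M => xy.1 != xy.2)
  (fun xy : M * M => kernel_distortion q xy.1 xy.2) xy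
  (fun xy _ => kernel_distortion_ge0 _ _ hq).
by exists xy'.
Qed.

Lemma max_min_distortionE p0 : (1 < #|M|)%N -> all_tree_probs o N p0 ->
  max_min_distortion o N p0 = worst_distortion (edge_law o p0).
Proof.
move=> M2 hp0; have [F [hF hpF]] := hp0.
have [[[x y] [ne E]] ub] := worst_distortionP M2 (edge_law_kernel hF hpF).
have infE (a b : M) : inf (distortion_values o N p0 a b) = kernel_distortion (edge_law o p0) a b.
  exact: minimum_inf (min_expected_distortion a b hp0).
apply: sup_attained; first by exists (x, y) => //=; rewrite infE E.
by move=> _ [[a b] /= ab <-]; rewrite infE ub.
Qed.

End Minimum.

(** * Norms on the transportation cost space *)

Section TransportNorm.
Variables (R : realType) (M : finMetricType R) (o : M).
Implicit Types (f : Lip0 R o) (mu : TC R o) (x y s t : M).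

(** On a finite space every function is Lipschitz; subtracting a constant makes it
    vanish at [o]. *)
Definition lip_of (g : M -> R) : Lip0 R o := vsproj (lip0 R o) [ffun x => g x - g o].

Lemma lip_ofE g x : vsval (lip_of g) x = g x - g o.
Proof. by rewrite vsprojK ?ffunE // mem_lip0 ffunE subrr. Qed.

Lemma lip0_base f : vsval f o = 0.
Proof. by apply/eqP; rewrite -mem_lip0 subvsP. Qed.

(** The weights in the representation [tc_delta] of [mu]. *)
Definition coef mu x : R := mu (lip_of (fun y => (y == x)%:R)).

Lemma tcE mu f : mu f = \sum_x vsval f x * coef mu x.
Proof.
have {1}-> : f = \sum_x vsval f x *: lip_of (fun y => (y == x)%:R).
  apply/val_inj/ffunP => y /=.
  rewrite (linear_sum (vsval (U := lip0 R o))) sum_ffunE /=.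
  have E x : vsval (vsval f x *: lip_of (fun y0 => (y0 == x)%:R)) y =
      vsval f x * ((y == x)%:R - (o == x)%:R).
    by rewrite linearZ /= ffunE lip_ofE.
  under eq_bigr do rewrite E mulrBr.
  rewrite sumrB (bigD1 y) //= eqxx mulr1 big1 => [|x]; last first.
    by rewrite eq_sym => /negPf ->; rewrite mulr0.
  rewrite (bigD1 o) //= eqxx lip0_base mul0r big1 ?addr0 ?subr0 // => x.
  by rewrite eq_sym => /negPf ->; rewrite mulr0.
rewrite linear_sum; apply: eq_bigr => x _.
by rewrite linearZ.
Qed.

Lemma tc_delta mu : mu = \sum_x coef mu x *: delta o x.
Proof.
apply/lfunP => f; rewrite tcE sum_lfunE; apply: eq_bigr => x _.
by rewrite lfunE /= deltaE mulrC.
Qed.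

Definition lip1 f := forall x y, `|vsval f x - vsval f y| <= mdist x y.

Lemma lip_norm_le1 f : lip_norm f <= 1 <-> lip1 f.
Proof.
pose S := [set L : R | 0 <= L /\
    forall x y : M, `|vsval f x - vsval f y| <= L * mdist x y].
split=> [le1 x y|f1]; last first.
  apply: ge_inf; first by exists 0 => L [].
  by split=> // x y; rewrite mul1r.
have [<-|xy] := eqVneq x y; first by rewrite subrr normr0 mdist_ge0.
have d0 : 0 < mdist x y by rewrite mdist_gt0.
rewrite -[leRHS]mul1r -ler_pdivrMr //; apply: le_trans le1.
apply: lb_le_inf => [|L [_ /(_ x y)]]; last by rewrite ler_pdivrMr.
exists (\sum_(ab : M * M) `|vsval f ab.1 - vsval f ab.2| / mdist ab.1 ab.2).
split=> [|a b]; first by apply: sumr_ge0 => ab _; rewrite divr_ge0 ?mdist_ge0.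
have [<-|ab] := eqVneq a b; first by rewrite subrr normr0 mdistxx mulr0.
rewrite -ler_pdivrMr ?mdist_gt0 // (bigD1 (a, b)) //= lerDl.
by apply: sumr_ge0 => ? _; rewrite divr_ge0 ?mdist_ge0.
Qed.

Lemma tc_norm_ub mu f : lip1 f -> mu f <= tc_norm mu.
Proof.
move=> /lip_norm_le1 f1; apply: ub_le_sup; last by exists f.
exists (\sum_x mdist x o * `|coef mu x|) => _ [g /lip_norm_le1 g1 <-].
rewrite tcE; apply: le_trans (ler_norm _) _; apply: le_trans (ler_norm_sum _ _ _) _.
apply: ler_sum => x _; rewrite normrM ler_wpM2r //.
by have := g1 x o; rewrite lip0_base subr0.
Qed.

Lemma tc_norm_le mu c : (forall f, lip1 f -> mu f <= c) -> tc_norm mu <= c.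
Proof.
move=> ub; apply: ge_sup => [|_ [f /lip_norm_le1 /ub ? <-] //].
exists (mu 0), 0 => //; apply/lip_norm_le1 => x y.
by rewrite linear0 !ffunE subrr normr0 mdist_ge0.
Qed.

Lemma tc_norm_ge0 mu : 0 <= tc_norm mu.
Proof.
rewrite -(linear0 mu); apply: tc_norm_ub => x y.
by rewrite linear0 !ffunE subrr normr0 mdist_ge0.
Qed.

Lemma tc_pairing_le mu f (K : R) : 0 <= K ->
  (forall x y, `|vsval f x - vsval f y| <= K * mdist x y) ->
  mu f <= K * tc_norm mu.
Proof.
rewrite le_eqVlt => /predU1P[<- f0|K0 fK].
  rewrite tcE big1 ?mul0r // => x _; have := f0 x o.
  by rewrite lip0_base subr0 mul0r normr_le0 => /eqP ->; rewrite mul0r.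
rewrite -ler_pdivrMl // -[_^-1 * _]/(K^-1 *: mu f) -linearZ; apply: tc_norm_ub => x y.
rewrite !linearZ /= !ffunE -mulrBr normrM gtr0_norm ?invr_gt0 //.
by rewrite ler_pdivrMl.
Qed.

(** The distance to [s] is the optimal potential for moving a unit mass away
    from [s]. *)
Lemma tc_norm_barycenter (a : R) s (r : M -> R) :
  (forall t, 0 <= r t) -> \sum_t r t = 1 ->
  tc_norm (a *: (delta o s - \sum_t r t *: delta o t)) =
  `|a| * \sum_t r t * mdist s t.
Proof.
move=> r0 r1; set mu := _ *: _.
have muE f : mu f = a * \sum_t r t * (vsval f s - vsval f t).
  rewrite /mu !lfunE /= !lfunE /= !lfunE /= sum_lfunE; congr (_ * _).
  under [RHS]eq_bigr do rewrite mulrBr.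
  rewrite sumrB -mulr_suml r1 mul1r; congr (_ - _).
  by apply: eq_bigr => t _; rewrite !lfunE /= deltaE.
apply/eqP; rewrite eq_le; apply/andP; split.
  apply: tc_norm_le => f f1; rewrite muE; apply: le_trans (ler_norm _) _.
  rewrite normrM ler_wpM2l //; apply: le_trans (ler_norm_sum _ _ _) _.
  by apply: ler_sum => t _; rewrite normrM ger0_norm // ler_wpM2l.
pose f := lip_of (fun t => - (Num.sg a * mdist s t)).
have f1 : lip1 f.
  move=> x y; rewrite !lip_ofE.
  have -> : - (Num.sg a * mdist s x) - - (Num.sg a * mdist s o) -
      (- (Num.sg a * mdist s y) - - (Num.sg a * mdist s o)) =
      Num.sg a * (mdist s y - mdist s x) by ring.
  rewrite normrM normr_sg; apply: (@le_trans _ _ `|mdist s y - mdist s x|).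
    by rewrite ler_piMl //; case: (a != 0).
  have := metric_triangle s x y; have := metric_triangle s y x.
  rewrite (metric_sym y x) ler_norml => *; apply/andP; split; lra.
apply: le_trans (tc_norm_ub mu f1); rewrite muE.
have E t : vsval f s - vsval f t = Num.sg a * mdist s t.
  by rewrite !lip_ofE mdistxx; ring.
under [X in _ <= a * X]eq_bigr do rewrite E mulrCA.
by rewrite -mulr_sumr mulrA [a * _]mulrC -normrEsg.
Qed.

Lemma tc_norm_delta (a : R) x y :
  tc_norm (a *: (delta o x - delta o y)) = `|a| * mdist x y.
Proof.
have E : delta o y = \sum_t (t == y)%:R *: delta o t.
  rewrite (bigD1 y) //= eqxx scale1r big1 ?addr0 // => t /negPf ->.
  by rewrite scale0r.
rewrite E tc_norm_barycenter //.
- congr (_ * _); rewrite (bigD1 y) //= eqxx mul1r big1 ?addr0 // => t /negPf ->.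
  by rewrite mul0r.
- by rewrite (bigD1 y) //= eqxx big1 ?addr0 // => t /negPf ->.
Qed.

End TransportNorm.

(** * The distortion of a basis *)

Section BasisDistortion.
Variables (R : realType) (M : finMetricType R) (o : M) (N : nat).
Implicit Types (b : N.-tuple (TC R o)) (mu : TC R o).

Definition basis_sum b mu : R := \sum_(i < N) `|coord b i mu| * tc_norm b`_i.

(** Absolute values are chosen signs, and with these signs fixed the sum is the
    pairing of [mu] with one function [g].  That function is as Lipschitz as the
    sum is large on the molecules [delta x - delta y], so these are the worst
    elements. *)
Lemma basis_sum_le b (K : R) mu : 0 <= K ->
  (forall x y, basis_sum b (delta o x - delta o y) <= K * mdist x y) ->
  basis_sum b mu <= K * tc_norm mu.
Proof.
move=> K0 hK.
pose g x := \sum_(i < N) Num.sg (coord b i mu) * tc_norm b`_i * coord b i (delta o x).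
have go : g o = 0.
  by rewrite /g big1 // => i _; rewrite delta_base linear0 mulr0.
have -> : basis_sum b mu = mu (lip_of o g).
  rewrite tcE; under eq_bigr do rewrite lip_ofE go subr0 /g mulr_suml.
  rewrite exchange_big; apply: eq_bigr => i _.
  have E : coord b i mu = \sum_x coef mu x * coord b i (delta o x).
    by rewrite {1}(tc_delta mu) linear_sum; apply: eq_bigr => x _; rewrite linearZ.
  rewrite normrEsg {2}E mulr_sumr mulr_suml.
  by apply: eq_bigr => x _; ring.
apply: tc_pairing_le => // x y; apply: le_trans (hK x y).
rewrite !lip_ofE go !subr0 /g -sumrB; apply: le_trans (ler_norm_sum _ _ _) _.
apply: ler_sum => i _; rewrite -mulrBr linearB normrM mulrC ler_wpM2l //.
rewrite normrM normr_sg (ger0_norm (tc_norm_ge0 _)).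
by case: (_ != 0); rewrite ?mul1r // mul0r tc_norm_ge0.
Qed.

Lemma basis_sumZ b (a : R) mu : basis_sum b (a *: mu) = `|a| * basis_sum b mu.
Proof.
rewrite /basis_sum mulr_sumr; apply: eq_bigr => i _.
by rewrite linearZ /= normrM mulrA.
Qed.

Variables (F : {ffun 'I_N.+1 -> M}) (q : M -> M -> R).
Hypotheses (hF : is_ordering o F) (hq : parent_kernel o F q).

Definition node (i : 'I_N) : M := F (lift ord0 i).

Lemma pos_node i : pos F (node i) = i.+1.
Proof. by rewrite (pos_ordering hF). Qed.

Lemma node_neq i : node i != o.
Proof. by apply/eqP => /(congr1 (pos F)); rewrite pos_node (pos_base hF). Qed.

Lemma node_inj : injective node.
Proof.
by move=> i j /(congr1 (pos F)); rewrite !pos_node => -[] /ord_inj.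
Qed.

Lemma nodeP s : s != o -> exists i, s = node i.
Proof.
have [[G FK GK] Fo] := hF; case: (unliftP ord0 (G s)) => [i Gs _|Gs].
  by exists i; rewrite /node -Gs GK.
by rewrite -(GK s) Gs Fo eqxx.
Qed.

Lemma sum_node (G : M -> R) : G o = 0 -> \sum_s G s = \sum_(i < N) G (node i).
Proof.
move=> Go; have [bij Fo] := hF.
rewrite (reindex F) /=; last exact: onW_bij.
by rewrite big_ord_recl Fo Go add0r.
Qed.

Definition kernel_vector s : TC R o := delta o s - \sum_t q s t *: delta o t.

Lemma coef_delta x s : s != o -> coef (delta o x) s = (x == s)%:R.
Proof. by move=> so; rewrite /coef deltaE lip_ofE (eq_sym o) (negPf so) subr0. Qed.

Lemma coef_sum_delta (r : M -> R) s : s != o -> coef (\sum_x r x *: delta o x) s = r s.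
Proof.
move=> so; rewrite /coef sum_lfunE (bigD1 s) //= big1 ?addr0 => [|x xs].
  by rewrite lfunE /= -/(coef _ _) coef_delta // eqxx -[_ *: _]/(_ * _) mulr1.
by rewrite lfunE /= -/(coef _ _) coef_delta // (negPf xs) scaler0.
Qed.

Lemma coef_kernel_vector s t : t != o -> coef (kernel_vector s) t = (s == t)%:R - q s t.
Proof.
move=> to; rewrite /kernel_vector /coef !lfunE /= opp_lfunE -!/(coef _ _).
by rewrite coef_delta // coef_sum_delta.
Qed.

(** Expanding in the vectors [kernel_vector s] amounts to solving the balance
    equations. *)
Lemma kernel_vector_expansion (v : M -> R) (mu : TC R o) : v o = 0 ->
  mu = \sum_s v s *: kernel_vector s ->
  forall t, t != o -> v t = coef mu t + \sum_(s | s != t) v s * q s t.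
Proof.
move=> vo mu_v t to.
have E : coef mu t = \sum_s v s * ((s == t)%:R - q s t).
  rewrite {1}mu_v /coef sum_lfunE; apply: eq_bigr => s _.
  by rewrite lfunE /= -[X in v s *: X]/(coef (kernel_vector s) t) coef_kernel_vector.
rewrite E (bigD1 t) //= eqxx (parent_kernel_diag hq to) subr0 mulr1 -addrA -big_split /=.
rewrite big1 ?addr0 // => s st.
by rewrite (negPf st) sub0r mulrN addNr.
Qed.

Variable b : N.-tuple (TC R o).
Hypotheses (hb : basis_of fullv b)
  (hbq : forall i : 'I_N, exists2 a : R, a != 0 & a *: b`_i = kernel_vector (node i)).

(** The kernel vectors are multiples [a i *: b`_i] of the basis vectors. In the
    products of a coordinate and a norm these scalars cancel. *)
Lemma basis_sum_molecule x y :
  basis_sum b (delta o x - delta o y) = \sum_s `|excess q x y s| * cost q s.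
Proof.
have [a a0 ab] : exists2 a : 'I_N -> R, (forall i, a i != 0) &
    forall i, a i *: b`_i = kernel_vector (node i).
  have [a ha] := boolp.choice (fun i => let: ex_intro2 z z0 zb := hbq i in
    ex_intro (fun z => z != 0 /\ z *: b`_i = kernel_vector (node i)) z (conj z0 zb)).
  by exists a => i; case: (ha i).
set mu := delta o x - delta o y.
pose v s := \sum_(i < N) (node i == s)%:R * (coord b i mu / a i).
have v_node i : v (node i) = coord b i mu / a i.
  rewrite /v (bigD1 i) //= eqxx mul1r big1 ?addr0 // => j ji.
  by rewrite (inj_eq node_inj) (negPf ji) mul0r.
have vo : v o = 0.
  by rewrite /v big1 // => i _; rewrite (negPf (node_neq i)) mul0r.
have mu_v : mu = \sum_s v s *: kernel_vector s.
  rewrite {1}(coord_basis hb (memvf mu)).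
  transitivity (\sum_(i < N) v (node i) *: kernel_vector (node i)).
    by apply: eq_bigr => i _; rewrite v_node -ab scalerA divfK.
  have [bij Fo] := hF; rewrite [RHS](reindex F) /=; last exact: onW_bij.
  by rewrite big_ord_recl Fo vo scale0r add0r.
have vE t : t != o -> v t = excess q x y t.
  move=> to; apply: (excess_unique hF hq) to => {}t to.
  rewrite {1}(kernel_vector_expansion vo mu_v to); congr (_ + _).
  rewrite -(coef_delta x to) -(coef_delta y to) /mu /coef !lfunE /= !lfunE /=.
  by rewrite lfunE.
rewrite sum_node ?(excess_base hF hq) ?normr0 ?mul0r //.
apply: eq_bigr => i _; rewrite -vE ?node_neq // v_node.
have [q0 q1 _] := hq.
have -> : b`_i = (a i)^-1 *: kernel_vector (node i) by rewrite -ab scalerA mulVf ?scale1r.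
rewrite tc_norm_barycenter // normrM mulrA normfV.
by rewrite -/(cost q (node i)).
Qed.

Lemma d1_worst_distortion : (1 < #|M|)%N -> d1 b = worst_distortion q.
Proof.
move=> M2; have [[[x y] /= [xy E]] ub] := worst_distortionP M2 hq.
have K0 : 0 <= worst_distortion q by rewrite E (kernel_distortion_ge0 _ _ hq).
have d0 : 0 < mdist x y by rewrite mdist_gt0.
apply: sup_attained.
  exists ((mdist x y)^-1 *: (delta o x - delta o y)) => /=.
    by rewrite tc_norm_delta ger0_norm ?invr_ge0 ?mdist_ge0 // mulVf ?gt_eqF.
  rewrite -/(basis_sum b _) basis_sumZ basis_sum_molecule E /kernel_distortion.
  by rewrite ger0_norm ?invr_ge0 ?mdist_ge0 // mulrC.
move=> _ [mu /= mu1 <-]; rewrite -/(basis_sum b mu) -[leRHS]mulr1 -mu1.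
apply: basis_sum_le => // a c; rewrite basis_sum_molecule.
have [<-|ac] := eqVneq a c.
  by rewrite big1 ?mdistxx ?mulr0 // => s _; rewrite /excess subrr normr0 mul0r.
by rewrite -ler_pdivrMr ?mdist_gt0 // ub.
Qed.

End BasisDistortion.

(** * Stochastic bases and parent kernels *)

Section StochasticBasis.
Variables (R : realType) (M : finMetricType R) (o : M) (N : nat).
Implicit Types (b : N.-tuple (TC R o)) (mu : TC R o).

Lemma canonical_projection_linear b n : linear (canonical_projection b n).
Proof.
move=> a mu nu; rewrite /canonical_projection scaler_sumr -big_split /=.
by apply: eq_bigr => i _; rewrite linearP scalerDl scalerA.
Qed.

HB.instance Definition _ b n := GRing.isLinear.Build R (TC R o) (TC R o) _
  (canonical_projection b n) (canonical_projection_linear b n).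

Lemma coord_projection b n (i : 'I_N) mu : free b ->
  coord b i (canonical_projection b n mu) = if (i < n)%N then coord b i mu else 0.
Proof.
move=> fb; rewrite /canonical_projection linear_sum /=.
rewrite (eq_bigr (fun j : 'I_N => coord b j mu * (i == j)%:R)); last first.
  by move=> j _; rewrite linearZ /= coord_free // eq_sym.
rewrite big_mkcond (bigD1 i) //= eqxx mulr1 big1 ?addr0 // => j.
by rewrite eq_sym => /negPf ->; rewrite mulr0 if_same.
Qed.

Lemma projection_comp b m n mu : free b -> (m <= n)%N ->
  canonical_projection b n (canonical_projection b m mu) = canonical_projection b m mu /\
  canonical_projection b m (canonical_projection b n mu) = canonical_projection b m mu.
Proof.
move=> fb mn; split; last first.
  apply: eq_bigr => i im; rewrite coord_projection //.
  by rewrite (leq_trans im mn).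
rewrite [LHS]/canonical_projection [RHS]big_mkcond [LHS]big_mkcond /=.
apply: eq_bigr => i _; rewrite coord_projection //.
by case: (ltnP i m) => im; rewrite ?scale0r ?if_same // (leq_trans im mn).
Qed.

Lemma projection_basis b n (i : 'I_N) : free b ->
  canonical_projection b n b`_i = if (i < n)%N then b`_i else 0.
Proof.
move=> fb; rewrite /canonical_projection big_mkcond (bigD1 i) //=.
rewrite coord_free // eqxx scale1r big1 ?addr0 // => j ji.
by rewrite coord_free // eq_sym (negPf ji) scale0r if_same.
Qed.

Lemma projection0 b mu : canonical_projection b 0 mu = 0.
Proof. by rewrite /canonical_projection big_pred0. Qed.

Lemma projection_delta b n mu : canonical_projection b n mu =
  \sum_x coef mu x *: canonical_projection b n (delta o x).
Proof.
by rewrite {1}(tc_delta mu) linear_sum; apply: eq_bigr => x _; rewrite linearZ.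
Qed.

Section FromKernel.
Variables (F : {ffun 'I_N.+1 -> M}) (q : M -> M -> R).
Hypotheses (hF : is_ordering o F) (hq : parent_kernel o F q).

Definition kernel_basis : N.-tuple (TC R o) :=
  [tuple kernel_vector o q (node F i) | i < N].

Lemma kernel_basisE (i : 'I_N) : kernel_basis`_i = kernel_vector o q (node F i).
Proof. by rewrite -tnth_nth tnth_mktuple. Qed.

Lemma delta_kernel s : delta o s = kernel_vector o q s + \sum_t q s t *: delta o t.
Proof. by rewrite /kernel_vector subrK. Qed.

Lemma ordering_ind (P : M -> Prop) : P o ->
  (forall i : 'I_N, (forall t, before F t (node F i) -> P t) -> P (node F i)) ->
  forall s, P s.
Proof.
move=> Po IH s; move: {2}(pos F s).+1 (ltnSn (pos F s)) => n.
elim: n s => // n IHn s le_n; have [->//|/(nodeP hF)[i si]] := eqVneq s o.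
rewrite si; apply: IH => t; rewrite -si => ts; apply: IHn.
exact: leq_trans ts le_n.
Qed.

Lemma kernel_basis_free : free kernel_basis.
Proof.
apply/freeP => k k0.
pose v s := \sum_(i < N) (node F i == s)%:R * k i.
have v_node i : v (node F i) = k i.
  rewrite /v (bigD1 i) //= eqxx mul1r big1 ?addr0 // => j ji.
  by rewrite (inj_eq (node_inj hF)) (negPf ji) mul0r.
have vo : v o = 0.
  by rewrite /v big1 // => i _; rewrite (negPf (node_neq hF i)) mul0r.
have v0 : 0 = \sum_s v s *: kernel_vector o q s.
  apply/esym; rewrite -[RHS]k0; have [bij Fo] := hF; rewrite (reindex F) /=; last exact: onW_bij.
  rewrite big_ord_recl Fo vo scale0r add0r; apply: eq_bigr => i _.
  by rewrite kernel_basisE -/(node F i) v_node.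
move=> i; rewrite -v_node.
have vE := kernel_vector_expansion hq vo v0.
apply: (balance_unique (v2 := fun=> 0) (parent_kernel_descending hq) _ vE) (node_neq hF i).
  move=> s t to qst; apply: contraNneq to => so; have [_ _ /(_ _ _ qst)] := hq.
  by rewrite so (before_baseN hF) orbF => /andP[].
move=> t _; rewrite /coef lfunE add0r big1 // => s _.
by rewrite mul0r.
Qed.

Lemma kernel_basis_basis : basis_of fullv kernel_basis.
Proof.
rewrite /basis_of kernel_basis_free andbT eqEsubv subvf /=.
apply/subvP => mu _; rewrite (tc_delta mu); apply: memv_suml => s _; apply: memvZ.
move: s; apply: ordering_ind => [|i IH]; first by rewrite delta_base mem0v.
rewrite delta_kernel memvD //.
  by rewrite -kernel_basisE memv_span // mem_nth // size_tuple.
apply: memv_suml => t _; have [->|qt] := eqVneq (q (node F i) t) 0.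
  by rewrite scale0r mem0v.
apply/memvZ/IH; have [_ _ /(_ _ _ qt)] := hq.
by rewrite (negPf (node_neq hF i)).
Qed.

(** The projection runs the chain [q] until it enters the initial segment [S]. Its
    law on arrival is found by induction along the ordering: the projection kills
    the kernel vector of a point outside [S], so it maps this point to the mean of
    the images of its possible parents. *)
Lemma kernel_basis_stochastic : stochastic_basis kernel_basis.
Proof.
have [q0 q1 q_supp] := hq; have fb := kernel_basis_free.
split=> [|n _]; first exact: kernel_basis_basis.
split; first exact: canonical_projection_linear.
pose S := [set x : M | (pos F x <= n)%N]%SET.
have oS : o \in S by rewrite inE (pos_base hF).
pose P := canonical_projection kernel_basis n.
pose dirac x : {ffun M -> R} := [ffun y => (y == x)%:R].
have dirac_sum x : \sum_y dirac x y *: delta o y = delta o x.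
  rewrite (bigD1 x) //= ffunE eqxx scale1r big1 ?addr0 // => y.
  by rewrite ffunE => /negPf ->; rewrite scale0r.
have dirac_dist x : x \in S -> is_dist_on [set` S] (dirac x).
  move=> xS; split=> [t||t]; rewrite ?ffunE //.
    rewrite (bigD1 x) //= ffunE eqxx big1 ?addr0 // => y.
    by rewrite ffunE => /negPf ->.
  by rewrite pnatr_eq0 eqb0 negbK /= => /eqP ->.
have P_delta i : P (delta o (node F i)) = (if (i < n)%N then kernel_basis`_i else 0) +
    \sum_t q (node F i) t *: P (delta o t).
  rewrite {1}delta_kernel /P linearD linear_sum /= -kernel_basisE projection_basis //.
  by congr (_ + _); apply: eq_bigr => t _; rewrite linearZ.
have ex x : exists r : {ffun M -> R}, [/\ is_dist_on [set` S] r,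
    x \in S -> r = dirac x & P (delta o x) = \sum_y r y *: delta o y].
  move: x; apply: ordering_ind => [|i IH].
    exists (dirac o); split=> //; first exact: dirac_dist.
    by rewrite dirac_sum delta_base /P linear0.
  set s := node F i in IH *; have so : s != o by exact: node_neq.
  have [iS|iS] := boolP (s \in S).
    exists (dirac s); split=> //; first exact: dirac_dist.
    have lt_in : (i < n)%N by move: iS; rewrite inE /s (pos_node hF).
    rewrite dirac_sum [RHS]delta_kernel P_delta lt_in kernel_basisE; congr (_ + _).
    apply: eq_bigr => t _; have [->|qt] := eqVneq (q s t) 0; first by rewrite !scale0r.
    have := q_supp _ _ qt; rewrite (negPf so) /= => ts.
    have [r [_ r_dirac ->]] := IH t ts; rewrite r_dirac ?dirac_sum //.
    by rewrite inE; apply: leq_trans (ltnW ts) _; move: iS; rewrite inE.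
  have ge_in : (i < n)%N = false.
    by apply/negbTE; move: iS; rewrite inE /s (pos_node hF).
  have ex_r t : exists r : {ffun M -> R}, before F t s ->
      is_dist_on [set` S] r /\ P (delta o t) = \sum_y r y *: delta o y.
    have [/IH[r [? _ ?]]|ts] := boolP (before F t s); last by exists (dirac o).
    by exists r.
  have [r hr] := boolp.choice ex_r.
  have supp t : q s t != 0 -> before F t s.
    by move=> /q_supp; rewrite (negPf so).
  exists [ffun y => \sum_t q s t * r t y]; split=> //; last first.
    rewrite P_delta ge_in add0r.
    under [RHS]eq_bigr do rewrite ffunE scaler_suml.
    rewrite [RHS]exchange_big; apply: eq_bigr => t _.
    have [->|/supp ts] := eqVneq (q s t) 0.
      by rewrite scale0r big1 // => y _; rewrite mul0r scale0r.
    have [_ ->] := hr t ts; rewrite scaler_sumr; apply: eq_bigr => y _.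
    by rewrite scalerA.
  split=> [y||y]; rewrite ?ffunE.
  - apply: sumr_ge0 => t _; have [->|/supp ts] := eqVneq (q s t) 0; first by rewrite mul0r.
    by rewrite mulr_ge0 //; have [[-> //]] := hr t ts.
  - under eq_bigr do rewrite ffunE.
    rewrite exchange_big /= -[RHS](q1 s); apply: eq_bigr => t _.
    have [->|/supp ts] := eqVneq (q s t) 0; first by rewrite big1 // => y _; rewrite mul0r.
    by rewrite -mulr_sumr; have [[_ -> _] _] := hr t ts; rewrite mulr1.
  - move=> /sum_neq0[t _]; rewrite mulf_eq0 negb_or => /andP[/supp ts rty].
    by have [[_ _ H] _] := hr t ts; exact: H.
have [r hr] := boolp.choice ex.
exists S, r; split=> // x; by have [] := hr x.
Qed.

End FromKernel.

Section ToKernel.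
Variable b : N.-tuple (TC R o).
Hypotheses (hb : stochastic_basis b) (hM : #|M| = N.+1).
Local Notation P := (canonical_projection b).

Let fb : free b. Proof. by have [/andP[]] := hb. Qed.

(** The zeroth projection is the constant retraction onto [o]. *)
Lemma stochastic_basis_retractions : exists (S : nat -> {set M})
    (r : nat -> M -> {ffun M -> R}), S 0%N = [set o]%SET /\
  forall n, (n <= N)%N ->
  [/\ o \in S n, forall x, is_dist_on [set` S n] (r n x),
      forall x, x \in S n -> r n x = [ffun y => (y == x)%:R]
    & forall x, P n (delta o x) = \sum_y r n x y *: delta o y].
Proof.
have ex n : exists Sr : {set M} * (M -> {ffun M -> R}), (n = 0%N -> Sr.1 = [set o]%SET) /\
    ((n <= N)%N -> [/\ o \in Sr.1, forall x, is_dist_on [set` Sr.1] (Sr.2 x),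
      forall x, x \in Sr.1 -> Sr.2 x = [ffun y => (y == x)%:R]
    & forall x, P n (delta o x) = \sum_y Sr.2 x y *: delta o y]).
  case: n => [|n]; last first.
    (* Beyond [N] any value will do. *)
    have [nN|nN] := leqP n.+1 N; last by exists ([set o]%SET, fun=> [ffun=> 0]).
    by have [_ /(_ n.+1 nN)[_ [S [r H]]]] := hb; exists (S, r).
  exists ([set o]%SET, fun=> [ffun y => (y == o)%:R]); split=> // _; split=> /=.
  - by rewrite inE.
  - move=> x; split=> [t||t]; rewrite ?ffunE //.
      by rewrite (bigD1 o) //= ffunE eqxx big1 ?addr0 // => y; rewrite ffunE => /negPf ->.
    by rewrite pnatr_eq0 eqb0 negbK => /eqP ->; rewrite /= inE.
  - by move=> x; rewrite inE => /eqP ->.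
  - move=> x; rewrite projection0 (bigD1 o) //= delta_base scaler0 add0r big1 // => y.
    by rewrite ffunE => /negPf ->; rewrite scale0r.
have [Sr hSr] := boolp.choice ex.
exists (fun n => (Sr n).1), (fun n => (Sr n).2); split=> [|n]; first by have [->] := hSr 0%N.
by have [_] := hSr n.
Qed.

(** The sets that the projections retract onto increase strictly, as equal sets
    would give equal projections; by counting they grow by exactly one point at
    each step, which orders [M]. The basis vector of a step spans the difference of
    two consecutive projections. At the new point [s] this difference is
    [kernel_vector s], for the kernel [q s] that the smaller projection gives. *)
Lemma stochastic_basis_kernel : exists (F : {ffun 'I_N.+1 -> M}) (q : M -> M -> R),
  [/\ is_ordering o F, parent_kernel o F q & forall i : 'I_N,
    exists2 a : R, a != 0 & a *: b`_i = kernel_vector o q (node F i)].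
Proof.
have [S [r [S0 hS]]] := stochastic_basis_retractions.
have fixS n x : (n <= N)%N -> x \in S n -> P n (delta o x) = delta o x.
  move=> nN xS; have [_ _ rS ->] := hS n nN; rewrite rS // (bigD1 x) //= ffunE eqxx.
  by rewrite scale1r big1 ?addr0 // => y; rewrite ffunE => /negPf ->; rewrite scale0r.
have Sfix n x : (n <= N)%N -> P n (delta o x) = delta o x -> x \in S n.
  move=> nN; have [oS r_dist _ ->] := hS n nN => E.
  have [->//|xo] := eqVneq x o; have [_ _ r_supp] := r_dist x.
  apply: r_supp; have /= := congr1 (fun mu => coef mu x) E.
  by rewrite coef_delta // coef_sum_delta // eqxx => ->; rewrite oner_eq0.
have S_step n : (n < N)%N -> S n \subset S n.+1.
  move=> nN; apply/fintype.subsetP => x xS; apply: Sfix => //.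
  rewrite -{1}(fixS n x (ltnW nN) xS).
  by have [-> _] := projection_comp (delta o x) fb (leqnSn n); exact: fixS (ltnW nN) xS.
have S_new n : (n < N)%N -> exists2 x, x \in S n.+1 & x \notin S n.
  move=> nN; apply/fintype.subsetPn/negP => sub.
  pose i := Ordinal nN.
  have fixP mu : P n (P n.+1 mu) = P n.+1 mu.
    rewrite (projection_delta b n.+1 mu) [LHS]linear_sum; apply: eq_bigr => x _.
    rewrite [LHS]linearZ /=; congr (_ *: _).
    have [_ r_dist _ ->] := hS n.+1 nN; rewrite [LHS]linear_sum; apply: eq_bigr => y _.
    rewrite [LHS]linearZ /=; have [->|ry] := eqVneq (r n.+1 x y) 0; first by rewrite !scale0r.
    congr (_ *: _); apply: fixS (ltnW nN) _; apply: (fintype.subsetP sub).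
    by have [_ _ H] := r_dist x; exact: H.
  have := fixP b`_i; rewrite (projection_basis n.+1 i fb) ltnSn.
  rewrite (projection_basis n i fb) ltnn => bi.
  by have := coord_free i i fb; rewrite -bi linear0 eqxx => /esym/eqP; rewrite oner_eq0.
have S_mono m n : (m <= n)%N -> (n <= N)%N -> S m \subset S n.
  elim: n => [|n IHn]; first by rewrite leqn0 => /eqP ->.
  rewrite leq_eqVlt => /predU1P[->//|mn nN].
  exact: fintype.subset_trans (IHn mn (ltnW nN)) (S_step n nN).
have exF (i : 'I_N.+1) : exists x, x \in S i /\
    forall m, (m < i)%N -> x \notin S m.
  case: i => -[|n] nN /=; first by exists o; rewrite S0 inE.
  have [x xS xN] := S_new n nN; exists x; split=> // m; rewrite ltnS => mn.
  by apply: contra xN; apply/fintype.subsetP; apply: S_mono => //; exact: ltnW.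
have [f hf] := boolp.choice exF; pose F := [ffun i => f i].
have Finj : injective F.
  move=> i j; rewrite !ffunE => fij; apply/ord_inj.
  have [xi yi] := hf i; have [xj yj] := hf j.
  case: (ltngtP i j) => // lt_ij.
    by have := yj i lt_ij; rewrite -fij xi.
  by have := yi j lt_ij; rewrite fij xj.
have hF : is_ordering o F.
  split; first by apply: inj_card_bij Finj _; rewrite hM card_ord.
  by have [/= + _] := hf ord0; rewrite S0 inE ffunE => /eqP.
have posS n x : (n <= N)%N -> x \in S n -> (pos F x <= n)%N.
  move=> nN xS; rewrite leqNgt; apply: contraTN xS.
  have [[G FK GK] _] := hF; rewrite -(GK x) (pos_ordering hF) ffunE.
  by have [_] := hf (G x); apply.
pose q s t : R := if s == o then (t == o)%:R else r (pos F s).-1 s t.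
have pred_le s : ((pos F s).-1 <= N)%N.
  have := pos_lt hF s; rewrite ltnS; apply: leq_trans; exact: leq_pred.
have hq : parent_kernel o F q.
  split=> [s t|s|s t]; rewrite /q.
  - case: eqP => // _; have [_ /(_ s)[+ _ _] _ _] := hS _ (pred_le s).
    exact.
  - case: eqP => _; last by have [_ /(_ s)[_ -> _] _ _] := hS _ (pred_le s).
    by rewrite (bigD1 o) //= eqxx big1 ?addr0 // => t /negPf ->.
  - case: (eqVneq s o) => [->|so] /=.
      by rewrite pnatr_eq0 eqb0 negbK => ->.
    have [_ /(_ s)[_ _ H] _ _] := hS _ (pred_le s).
    move=> /H /= /(posS _ _ (pred_le s)); rewrite /before.
    have : (0 < pos F s)%N by rewrite lt0n -(pos_base hF) (pos_eq hF).
    by case: (pos F s).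
exists F, q; split=> // i; set s := node F i.
have ps : pos F s = i.+1 by exact: (pos_node hF).
have so : s != o by exact: (node_neq hF).
have iN : (i <= N)%N by exact: ltnW.
have [sS sN] : s \in S i.+1 /\ s \notin S i.
  by rewrite /s /node ffunE; have [xi yi] := hf (lift ord0 i); split=> //; exact: yi.
have E : kernel_vector o q s = delta o s - P i (delta o s).
  rewrite /kernel_vector /q (negPf so) ps /=; congr (_ - _).
  by have [_ _ _ ->] := hS _ iN.
have step : P i.+1 (delta o s) = P i (delta o s) + coord b i (delta o s) *: b`_i.
  rewrite /canonical_projection [LHS]big_mkcond [X in X + _]big_mkcond /=.
  rewrite (bigD1 i) //= [in RHS](bigD1 i) //= ltnSn ltnn add0r addrC; congr (_ + _).
  by apply: eq_bigr => j ji; rewrite ltnS leq_eqVlt -val_eqE /= in ji *; rewrite (negPf ji).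
have Ei : coord b i (delta o s) *: b`_i = kernel_vector o q s.
  by rewrite E -{2}(fixS i.+1 s (ltn_ord i) sS) step addrAC subrr add0r.
exists (coord b i (delta o s)) => //.
apply: contra sN => /eqP a0; apply: Sfix => //.
by apply/esym/eqP; rewrite -subr_eq0 -E -Ei a0 scale0r.
Qed.

End ToKernel.

Lemma d1_valuesP c : (1 < #|M|)%N -> #|M| = N.+1 ->
  d1_values o N c <-> exists F q,
    [/\ is_ordering o (F : {ffun 'I_N.+1 -> M}), parent_kernel o F q & worst_distortion q = c].
Proof.
move=> M2 hM; split=> [[b hb <-]|[F [q [hF hq <-]]]].
  have [F [q [hF hq hbq]]] := stochastic_basis_kernel hb hM.
  exists F, q; split=> //; apply/esym.
  by apply: (d1_worst_distortion hF hq _ hbq) => //; case: hb.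
have hs := kernel_basis_stochastic hF hq.
exists (kernel_basis F q) => //; apply: (d1_worst_distortion hF hq) => //.
  by case: hs.
by move=> i; exists 1; rewrite ?oner_eq0 // scale1r kernel_basisE.
Qed.

End StochasticBasis.

(** * Compactness of the parent kernels *)

Section Compactness.
Variables (R : realType) (M : finMetricType R) (o : M) (N : nat).
Implicit Types (F : {ffun 'I_N.+1 -> M}).
Local Notation K := {ptws (M * M)%type -> R}.

Lemma mul_fun_continuous (T : topologicalType) (f g : T -> R) :
  continuous f -> continuous g -> continuous (fun x => f x * g x).
Proof. by move=> fc gc x; apply: cvgM; [exact: fc|exact: gc]. Qed.

Lemma dist_fun_continuous (T : topologicalType) (f g : T -> R) :
  continuous f -> continuous g -> continuous (fun x => `|f x - g x|).
Proof.
by move=> fc gc x; apply: cvg_norm; apply: cvgB; [exact: fc|exact: gc].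
Qed.

Definition kernel_of (q : K) s t : R := q (s, t).

Lemma coordinate_continuous s t : continuous (fun q : K => q (s, t)).
Proof. exact: (@proj_continuous _ (fun=> R) (s, t)). Qed.

Lemma sum_continuous (I : Type) (r : seq I) (P : pred I) (f : I -> K -> R) :
  (forall i, continuous (f i)) ->
  continuous (fun q : K => \sum_(i <- r | P i) f i q).
Proof. by move=> fc; apply: continuous_big => //; exact: add_continuous. Qed.

Lemma visit_continuous x s : continuous (fun q : K => visit (kernel_of q) x s).
Proof.
apply: (@sum_continuous _ _ xpredT
  (fun (f : {ffun M -> M}) (q : K) => prod_law (kernel_of q) f * (fconnect f x s)%:R)).
move=> f; apply: (@mul_fun_continuous K (fun q => prod_law (kernel_of q) f)
  (fun=> (fconnect f x s)%:R)); last exact: cst_continuous.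
apply: (@continuous_big R _ *%R 1 xpredT mul_continuous K (index_enum M)
  (fun s (q : K) => q (s, f s))) => r _.
exact: coordinate_continuous.
Qed.

Lemma cost_continuous s : continuous (fun q : K => cost (kernel_of q) s).
Proof.
apply: (@sum_continuous _ _ xpredT (fun t (q : K) => q (s, t) * mdist s t)) => t.
apply: (@mul_fun_continuous K (fun q => q (s, t)) (fun=> mdist s t)).
  exact: coordinate_continuous.
exact: cst_continuous.
Qed.

Lemma worst_distortion_continuous :
  continuous (fun q : K => worst_distortion (kernel_of q)).
Proof.
apply: (@continuous_big R _ _ _ _ max_continuous K _
  (fun xy (q : K) => kernel_distortion (kernel_of q) xy.1 xy.2)) => -[x y] _.
apply: (@mul_fun_continuous K
  (fun q => \sum_s `|excess (kernel_of q) x y s| * cost (kernel_of q) s)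
  (fun=> (mdist x y)^-1)); last exact: cst_continuous.
apply: (@sum_continuous _ _ xpredT
  (fun s (q : K) => `|excess (kernel_of q) x y s| * cost (kernel_of q) s)) => s.
apply: (@mul_fun_continuous K (fun q => `|excess (kernel_of q) x y s|)
  (fun q => cost (kernel_of q) s)); last exact: cost_continuous.
apply: (@dist_fun_continuous K (fun q => visit (kernel_of q) x s)
  (fun q => visit (kernel_of q) y s)); exact: visit_continuous.
Qed.

(** A closed subset of a product of segments and points. *)
Lemma parent_kernels_compact F : is_ordering o F ->
  compact [set q : K | parent_kernel o F (kernel_of q)].
Proof.
move=> hF.
pose allowed (st : M * M) := (st.1 == o) && (st.2 == o) || before F st.2 st.1.
pose box (st : M * M) : set R := if allowed st then `[0, 1]%classic else [set 0].
have -> : [set q : K | parent_kernel o F (kernel_of q)] =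
    [set q : K | forall st, box st (q st)] `&`
    \bigcap_(s in [set: M]) [set q : K | \sum_t q (s, t) = 1].
  apply/seteqP; split=> [q [q0 q1 q_supp]|q [q_box q_sum]]; split.
  - move=> [s t]; rewrite /box; case: ifPn => [_|nst].
      rewrite /= in_itv /= (q0 s t) /= -(q1 s) (bigD1 t) //= lerDl.
      by apply: sumr_ge0 => r _; exact: q0.
    by apply/eqP/negPn/negP => /q_supp; rewrite -[_ || _]/(allowed (s, t)) (negPf nst).
  - by move=> s _; exact: q1.
  - move=> s t; have := q_box (s, t); rewrite /box; case: ifP => _ /=.
      by rewrite in_itv => /andP[].
    by rewrite /kernel_of => ->.
  - by move=> s; exact: q_sum.
  - move=> s t; have := q_box (s, t); rewrite /box; case: ifP => //= _.
    by rewrite /kernel_of => ->; rewrite eqxx.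
apply: compact_closedI.
  apply: (@tychonoff _ (fun=> R) box) => st; rewrite /box; case: ifP => _.
    exact: segment_compact.
  exact: compact_set1.
apply: closed_bigI => s _.
apply: (@closed_comp _ _ (fun q : K => \sum_t q (s, t)) [set 1]).
  by move=> q _; apply: sum_continuous => t; exact: coordinate_continuous.
exact: closed_eq.
Qed.

Lemma ordering_exists : #|M| = N.+1 -> exists F, is_ordering o F.
Proof.
move=> hM; pose l := o :: rem o (enum M).
have perm_l : perm_eq (enum M) l by apply: perm_to_rem; rewrite mem_enum.
have size_l : size l = N.+1 by rewrite -(perm_size perm_l) -cardE.
have uniq_l : uniq l by rewrite -(perm_uniq perm_l) enum_uniq.
pose F := [ffun i : 'I_N.+1 => nth o l i].
exists F; split; last by rewrite ffunE.
apply: inj_card_bij; last by rewrite hM card_ord.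
move=> i j; rewrite !ffunE => /eqP.
by rewrite nth_uniq ?size_l // => /eqP/ord_inj.
Qed.

Lemma parent_kernel_exists F : is_ordering o F -> exists q, parent_kernel o F q.
Proof.
move=> hF; exists (fun s t => (t == o)%:R); split=> // [s|s t].
  by rewrite (bigD1 o) //= eqxx big1 ?addr0 // => t /negPf ->.
rewrite pnatr_eq0 eqb0 negbK => /eqP ->; rewrite eqxx andbT (before_base hF).
by case: (s == o).
Qed.

Lemma optimal_kernel : #|M| = N.+1 -> exists F q,
  [/\ is_ordering o (F : {ffun 'I_N.+1 -> M}), parent_kernel o F q &
    forall F' q', is_ordering o (F' : {ffun 'I_N.+1 -> M}) -> parent_kernel o F' q' ->
      worst_distortion q <= worst_distortion q'].
Proof.
move=> hM.
have opt F : exists q : M -> M -> R, is_ordering o F -> parent_kernel o F q /\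
    forall q', parent_kernel o F q' -> worst_distortion q <= worst_distortion q'.
  have [hF|nF] := pselect (is_ordering o F); last by exists (fun _ _ => 0).
  have [q0 hq0] := parent_kernel_exists hF.
  have [|q /set_mem hq q_min] := compact_EVT_min _ (parent_kernels_compact hF)
    (continuous_subspaceT worst_distortion_continuous).
    by exists (fun st => q0 st.1 st.2).
  exists (kernel_of q) => _; split=> // q' hq'.
  by apply: (q_min (fun st => q' st.1 st.2)); rewrite inE.
have [q hq] := boolp.choice opt.
have [F0 hF0] := ordering_exists hM.
have F0P : `[< is_ordering o F0 >] by exact/asboolP.
pose P := fun F : {ffun 'I_N.+1 -> M} => `[< is_ordering o F >].
have [F /asboolP hF F_min] :=
  @Order.TotalTheory.arg_minP _ R _ F0 P (fun F => worst_distortion (q F)) F0P.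
exists F, (q F); split=> //; first by case: (hq F hF).
move=> F' q' hF' hq'; apply: le_trans (F_min F' _) _; first exact/asboolP.
by have [_] := hq F' hF'; apply.
Qed.

End Compactness.

(** * The stochastic distortion *)

Theorem theorem1 (R : realType) (M : finMetricType R) (o : M) (N : nat) (C : R)
    (hN : (1 <= N)%N) (hM : #|M| = N.+1) (hC : 1 <= C) :
  (sd1 o N < C <->
     exists p0, all_tree_probs o N p0 /\
       forall x y : M, x != y ->
         exists p, indep_class o N p0 x y p /\ expected_distortion p x y < C)
  /\ [/\ is_minimum (d1_values o N) (sd1 o N),
         forall p0, all_tree_probs o N p0 -> forall x y : M, x != y ->
           is_minimum (distortion_values o N p0 x y)
             (inf (distortion_values o N p0 x y))
       & is_minimum (max_min_values o N) (sd1 o N)].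
Proof.
have M2 : (1 < #|M|)%N by rewrite hM.
have [F [q [hF hq q_min]]] := optimal_kernel o hM.
have d1_min : is_minimum (d1_values o N) (worst_distortion q).
  split; first by apply/d1_valuesP => //; exists F, q.
  by move=> _ /(d1_valuesP _ _ M2 hM)[F' [q' [hF' hq' <-]]]; exact: q_min hF' hq'.
have sd1E : sd1 o N = worst_distortion q by exact: minimum_inf.
have max_min_min : is_minimum (max_min_values o N) (worst_distortion q).
  split=> [|_ [p0 hp0 <-]]; last first.
    rewrite max_min_distortionE //; have [F' [hF' hp]] := hp0.
    exact: q_min hF' (edge_law_kernel hF' hp).
  have [p [hp <- _ _]] := coupled_tree_law o o hF hq.
  have hp' : all_tree_probs o N p by exists F.
  by exists p => //; exact: max_min_distortionE.
split; last first.
  rewrite sd1E; split=> // p0 hp0 x y _.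
  have hmin := min_expected_distortion x y hp0.
  by rewrite (minimum_inf hmin).
rewrite sd1E; split=> [ltC|[p0 [hp0 ltC]]].
  have [[p0 hp0 p0E] _] := max_min_min; exists p0; split=> // x y xy.
  have [[p hp pE] _] := min_expected_distortion x y hp0; exists p; split=> //.
  rewrite pE; apply: le_lt_trans ltC; rewrite -p0E max_min_distortionE //.
  have [F' [hF' hp']] := hp0.
  by have [_] := worst_distortionP M2 (edge_law_kernel hF' hp'); apply.
have [_ lb] := max_min_min.
apply: le_lt_trans (lb _ (ex_intro2 _ _ p0 hp0 erefl)) _.
rewrite max_min_distortionE //; have [F' [hF' hp']] := hp0.
have [[[x y] /= [xy ->]] _] := worst_distortionP M2 (edge_law_kernel hF' hp').
have [p [hp pC]] := ltC x y xy; apply: le_lt_trans pC.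
by have [_] := min_expected_distortion x y hp0; apply; exists p.
Qed.
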